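(* There exist a dynamical system $(X,\mathscr{A},\mu,T)$, where $T$ is an ergodic automorphism of the Lebesgue space $(X,\mathscr{A},\mu)$, and a factor $\mathscr{H}$ of $T$, such that $T$ is $\mathscr{H}$-relatively twofold mixing but not $\mathscr{H}$-relatively threefold mixing.
   Context: A Lebesgue space is a standard probability space; an automorphism of it is an (almost everywhere) invertible bimeasurable measure-preserving map. A factor of $T$ is a sub-$\sigma$-algebra $\mathscr{H}$ of $\mathscr{A}$ such that $\mathscr{H}=T^{-1}\mathscr{H}$. For $A\in\mathscr{A}$, $\mu(A|\mathscr{H})$ denotes the conditional probability of $A$ given $\mathscr{H}$. $T$ is $\mathscr{H}$-relatively mixing (equivalently, $\mathscr{H}$-relatively twofold mixing) if for all $A,B\in\mathscr{A}$, $$\mu\left(A\cap T^{-k}B|\mathscr{H}\right)-\mu(A|\mathscr{H})\,\mu(T^{-k}B|\mathscr{H})\longrightarrow 0\quad\text{in probability as }k\to+\infty.$$ $T$ is $\mathscr{H}$-relatively threefold mixing if for all $A,B,C\in\mathscr{A}$, $$\mu\left(A\cap T^{-j}B\cap T^{-k}C|\mathscr{H}\right)-\mu(A|\mathscr{H})\,\mu(T^{-j}B|\mathscr{H})\,\mu(T^{-k}C|\mathscr{H})\longrightarrow 0\quad\text{in probability as }j\to+\infty\text{ and }k-j\to+\infty.$$ *)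

(* Defs.v *)
From HB Require Import structures.
From mathcomp Require Import all_boot all_order all_algebra.
From mathcomp Require Import all_classical all_reals all_analysis.
From mathcomp Require Import measurable_realfun.

Set Implicit Arguments.
Unset Strict Implicit.
Unset Printing Implicit Defensive.

Import Order.TTheory GRing.Theory Num.Theory.
Import numFieldNormedType.Exports.
Local Open Scope classical_set_scope.
Local Open Scope ring_scope.

(* The sigma-algebra of [X] is the Borel sigma-algebra of a Polish space.  For
   (pseudo)metrizable spaces, second countability is the same as separability,
   and a Hausdorff pseudometric space is a metric space. *)
Definition standard_borel (R : realType) (d : measure_display)
    (X : measurableType d) : Prop :=
  exists (Y : completePseudoMetricType R) (f : X -> Y),
    [/\ hausdorff_space Y, @second_countable Y, bijective f &
        forall A : set X, measurable A <-> <<s @open Y >> (f @` A)].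

(* [mu] ranges over all Borel probability measures; sets are not completed
   by the [mu]-null sets. *)
Definition lebesgue_space (R : realType) (d : measure_display)
    (X : measurableType d) (mu : probability X R) : Prop :=
  standard_borel R X.

(* The inverse [S] preserves [mu] automatically:
   mu (S^-1 A) = mu (T^-1 (S^-1 A)) = mu A. *)
Definition automorphism (R : realType) (d : measure_display)
    (X : measurableType d) (mu : probability X R) (T : X -> X) : Prop :=
  [/\ measurable_fun setT T,
      forall A, measurable A -> mu (T @^-1` A) = mu A &
      exists S : X -> X,
        [/\ measurable_fun setT S,
            {ae mu, forall x, S (T x) = x} &
            {ae mu, forall x, T (S x) = x}]].

Definition ergodic (R : realType) (d : measure_display)
    (X : measurableType d) (mu : probability X R) (T : X -> X) : Prop :=
  forall A, measurable A -> T @^-1` A = A -> mu A = 0%E \/ mu A = 1%E.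

Definition is_factor (d : measure_display) (X : measurableType d)
    (T : X -> X) (H : set (set X)) : Prop :=
  [/\ sigma_algebra setT H,
      H `<=` measurable &
      [set T @^-1` A | A in H] = H].

Definition is_cond_prob (R : realType) (d : measure_display)
    (X : measurableType d) (mu : probability X R) (H : set (set X))
    (A : set X) (f : X -> R) : Prop :=
  [/\ measurable_fun setT (f : g_sigma_algebraType H -> R),
      mu.-integrable setT (EFin \o f) &
      forall B, H B -> (\int[mu]_(x in B) (f x)%:E = mu (A `&` B))%E].

(* A version of mu(A|H), chosen among the almost everywhere equal ones;
   [cond_probP] below shows that the default value is never used. *)
Definition cond_prob (R : realType) (d : measure_display)
    (X : measurableType d) (mu : probability X R) (H : set (set X))
    (A : set X) : X -> R :=
  xget (fun=> 0) [set f : X -> R | is_cond_prob mu H A f].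

(* mu(A | i = y) as a function of y, by the Radon-Nikodym theorem on [Y]. *)
Lemma cond_density (R : realType) (d d' : measure_display)
    (X : measurableType d) (Y : measurableType d') (i : X -> Y)
    (mu : probability X R) (A : set X) :
  measurable_fun setT i -> measurable A ->
  exists f : Y -> R,
    [/\ measurable_fun setT f, mu.-integrable setT (fun x => (f (i x))%:E) &
        forall B, measurable B ->
          (\int[mu]_(x in i @^-1` B) (f (i x))%:E = mu (A `&` i @^-1` B))%E].
Proof.
move=> mi mA.
have mpre B : measurable B -> measurable (i @^-1` B).
  by move=> mB; rewrite -[X in measurable X]setTI; exact: mi.
have sgf (k : {measure set Y -> \bar R}) : fin_num_fun k -> sigma_finite setT k.
  by move=> kfin; apply: fin_num_fun_sigma_finite => //; rewrite measure0.
have sf (k : {measure set Y -> \bar R}) : fin_num_fun k -> sfinite_measure k.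
  by move=> /sgf; exact: sfinite_measure_sigma_finite.
pose m0 : {measure set Y -> \bar R} :=
  measure_function_pushforward__canonical__measure_function_Measure mu mi.
have mfin : fin_num_fun m0.
  by move=> B mB; apply: fin_num_measure; exact: mpre.
pose m : {finite_measure set Y -> \bar R} :=
  HB.pack_for (FiniteMeasure.type Y R) (Measure.sort m0)
    (isFinite.Build _ _ _ _ mfin) (isSFinite.Build _ _ _ _ (sf _ mfin))
    (isSigmaFinite.Build _ _ _ _ (sgf _ mfin)).
pose n0 : {measure set Y -> \bar R} :=
  measure_function_pushforward__canonical__measure_function_Measure
    (mrestr mu mA) mi.
have nfin : fin_num_fun n0.
  by move=> B mB; apply: fin_num_measure; exact: mpre.
pose n : {finite_measure set Y -> \bar R} :=
  HB.pack_for (FiniteMeasure.type Y R) (Measure.sort n0)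
    (isFinite.Build _ _ _ _ nfin) (isSFinite.Build _ _ _ _ (sf _ nfin))
    (isSigmaFinite.Build _ _ _ _ (sgf _ nfin)).
have nm : n `<< m.
  apply/null_content_dominatesP => B mB mB0.
  apply/eqP; rewrite eq_le measure_ge0 andbT -[leRHS]mB0.
  by apply: le_measure; rewrite ?inE//; [apply: measurableI => //|];
    exact: mpre.
have [f [f_ge0 f_fin intf nE]] := radon_nikodym_sigma_finite nm.
have mf : measurable_fun setT f by case/integrableP: intf.
have fK x : (fine (f x))%:E = f x by rewrite fineK.
have fE B : measurable B ->
    (\int[mu]_(x in i @^-1` B) f (i x) = mu (A `&` i @^-1` B))%E.
  move=> mB; rewrite setIC -[RHS]/(n B) nE//; apply/esym.
  by apply: (ge0_integral_pushforward mi) => //; exact: measurable_funTS.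
exists (fine \o f); split.
- exact: (measurableT_comp (fine_measurable measurableT) mf).
- under eq_fun do rewrite /= fK.
  apply/integrableP; split; first exact: (measurableT_comp mf mi).
  under eq_integral do rewrite gee0_abs//.
  rewrite -(preimage_setT i) fE//.
  by rewrite (le_lt_trans (probability_le1 _ _)) ?ltry// preimage_setT setIT.
- by move=> B mB; under eq_integral do rewrite /= fK; exact: fE.
Qed.

Lemma cond_probP (R : realType) (d : measure_display) (X : measurableType d)
    (mu : probability X R) (H : set (set X)) (A : set X) :
  sigma_algebra setT H -> H `<=` measurable -> measurable A ->
  is_cond_prob mu H A (cond_prob mu H A).
Proof.
move=> sH HM mA.
have gH : <<s H >> = H by exact: sigma_algebra_id.
have mi : measurable_fun setT (id : X -> g_sigma_algebraType H).
  move=> _ B; rewrite setTI => mB; apply: HM; rewrite -gH; exact: mB.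
have [f [mf intf fE]] := cond_density mu mi mA.
apply: (@xgetPex _ _ [set f | is_cond_prob mu H A f]).
exists f; split => // B HB; apply: fE.
by rewrite -gH in HB.
Qed.

Definition cvg0_in_probability (R : realType) (d : measure_display)
    (X : measurableType d) (mu : probability X R) (I : Type)
    (f : I -> X -> R) (F : set_system I) : Prop :=
  forall e : R, 0 < e -> mu [set x | e < `|f i x|] @[i --> F] --> 0%E.

Definition relatively_mixing (R : realType) (d : measure_display)
    (X : measurableType d) (mu : probability X R) (H : set (set X))
    (T : X -> X) : Prop :=
  forall A B, measurable A -> measurable B ->
    cvg0_in_probability mu
      (fun (k : nat) x =>
         cond_prob mu H (A `&` iter k T @^-1` B) x
         - cond_prob mu H A x * cond_prob mu H (iter k T @^-1` B) x)
      \oo.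

(* j --> +oo and k - j --> +oo, for pairs (j, k) of natural numbers. *)
Definition gap_filter : set_system (nat * nat) :=
  [set P | exists N : nat, forall j k : nat,
     (N <= j)%N -> (j + N <= k)%N -> P (j, k)].

Lemma gap_filter_proper : ProperFilter gap_filter.
Proof.
split.
  by move=> [N /(_ N (N + N)%N)]; apply.
split; first by exists 0%N.
- move=> P Q [M MP] [N NQ]; exists (maxn M N) => j k; rewrite geq_max.
  move=> /andP[Mj Nj] jk; split; [apply: MP|apply: NQ] => //;
    by rewrite (leq_trans _ jk)// leq_add2l ?leq_maxl ?leq_maxr.
- by move=> P Q PQ [N NP]; exists N => j k ? ?; exact/PQ/NP.
Qed.

Definition relatively_threefold_mixing (R : realType) (d : measure_display)
    (X : measurableType d) (mu : probability X R) (H : set (set X))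
    (T : X -> X) : Prop :=
  forall A B C, measurable A -> measurable B -> measurable C ->
    cvg0_in_probability mu
      (fun (jk : nat * nat) x =>
         cond_prob mu H
           (A `&` iter jk.1 T @^-1` B `&` iter jk.2 T @^-1` C) x
         - cond_prob mu H A x
           * cond_prob mu H (iter jk.1 T @^-1` B) x
           * cond_prob mu H (iter jk.2 T @^-1` C) x)
      gap_filter.

(* Main.v *)
Require Import Defs.
From HB Require Import structures.
From mathcomp Require Import all_boot all_order all_algebra.
From mathcomp Require Import all_classical all_reals all_analysis.
From mathcomp Require Import measurable_realfun zify ring lra.

Set Implicit Arguments.
Unset Strict Implicit.
Unset Printing Implicit Defensive.

Import Order.TTheory GRing.Theory Num.Theory.
Import numFieldNormedType.Exports.
Local Open Scope classical_set_scope.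
Local Open Scope ring_scope.

(** The base is the 3-adic odometer [odo] on sequences of digits 0, 1, 2, and
    the fibre over [y] is made of independent uniform digits.  For every m let
    [spin m] be the map (a, b) |-> (b, - a - b), of order 3, on the first two
    blocks of 2^m fibre digits, and write a fibre point as x = [mix p y] z,
    where [mix p y] applies each [spin m], m < p, as many times as the digit
    [y m] says.  The skew product [tower] moves y to [odo y] and keeps z.

    If m is the highest digit where y and its n-th iterate y' differ, then
    x = [mix p y] z and x' = [mix p y'] z read two different entries of an
    orbit a, b, - a - b, which are independent, and m is large when n is.  This
    gives relative twofold mixing, first for finitely determined sets and then
    for all sets by approximation.  When [y m = 0], the times 0, 3^m and
    2 * 3^m see the three entries, whose sum is 0: relative threefold mixing
    fails on a set of measure 1/3.  Ergodicity follows from relative mixing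
    and the ergodicity of the odometer. *)

(** * The 3-adic odometer *)

Definition digits := nat -> 'Z_3.

Definition agree (q : nat) (x x' : digits) : Prop :=
  forall i, (i < q)%N -> x i = x' i.

Lemma agree_sym q x y : agree q x y -> agree q y x.
Proof. by move=> h i iq; rewrite h. Qed.

Lemma agree_trans q y x z : agree q x y -> agree q y z -> agree q x z.
Proof. by move=> h h' i iq; rewrite h ?h'. Qed.

Lemma agree_leq q r x y : (q <= r)%N -> agree r x y -> agree q x y.
Proof. by move=> qr h i iq; apply: h; exact: leq_trans qr. Qed.

Definition level (q : nat) (A : set digits) : Prop :=
  forall x x', agree q x x' -> A x -> A x'.

Lemma level_leq q r A : (q <= r)%N -> level q A -> level r A.
Proof. by move=> qr lA x x' h; apply: lA; exact: agree_leq h. Qed.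

(** The carry condition: adding one changes digit [q] exactly when every lower digit is 2. *)
Definition full (q : nat) (y : digits) : bool := all (fun j => y j == 2) (iota 0 q).

Definition odo (y : digits) : digits := fun i => y i + (full i y)%:R.

Definition mirror (y : digits) : digits := fun i => 2 - y i.

(* [mirror y = -1 - y] in the 3-adic integers. *)
Definition odo_inv (y : digits) : digits := mirror (odo (mirror y)).

(** The residue of [y] modulo 3^q. Digits come least significant first, opposite to [msb] below. *)
Definition value (q : nat) (y : digits) : nat := \sum_(i < q) y i * 3 ^ i.

Lemma fullS q y : full q.+1 y = full q y && (y q == 2).
Proof. by rewrite /full -(addn1 q) iotaD all_cat /= add0n andbT. Qed.

Lemma full_agree q y y' : agree q y y' -> full q y = full q y'.
Proof.
move=> h; apply: eq_in_all => i; rewrite mem_iota add0n => /andP[_ iq].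
by rewrite h.
Qed.

Lemma fullP q y : reflect (forall i, (i < q)%N -> y i = 2) (full q y).
Proof.
apply: (iffP allP) => [h i iq|h i]; first by apply/eqP/h; rewrite mem_iota.
by rewrite mem_iota add0n => /andP[_ iq]; rewrite h.
Qed.

Lemma odo_agree q y y' : agree q y y' -> agree q (odo y) (odo y').
Proof.
move=> h i iq; rewrite /odo h // (@full_agree i y y') //.
by apply: agree_leq h; exact: ltnW.
Qed.

Lemma mirrorK : involutive mirror.
Proof. by move=> y; apply/funext => i; rewrite /mirror opprB addrCA subrr addr0. Qed.

Lemma mirror_agree q y y' : agree q y y' -> agree q (mirror y) (mirror y').
Proof. by move=> h i iq; rewrite /mirror h. Qed.

Lemma odo_inv_agree q y y' : agree q y y' -> agree q (odo_inv y) (odo_inv y').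
Proof. by move=> h; apply: mirror_agree; apply: odo_agree; exact: mirror_agree. Qed.

Lemma full_mirror_odo q y : full q (mirror (odo y)) = full q y.
Proof.
elim: q => // q IH; rewrite !fullS IH; case fq: (full q y) => //=.
rewrite /mirror /odo fq; case: (y q) => [[|[|[|//]]] hi] /=; reflexivity.
Qed.

Lemma odoK : cancel odo odo_inv.
Proof.
move=> y; apply/funext => i; rewrite /odo_inv /mirror {1}/odo full_mirror_odo.
by rewrite {1}/odo /mirror; ring.
Qed.

Lemma odo_invK : cancel odo_inv odo.
Proof. by move=> y; rewrite -[RHS]mirrorK -[mirror y]odoK /odo_inv !mirrorK. Qed.

Lemma valueS q y : value q.+1 y = (value q y + y q * 3 ^ q)%N.
Proof. by rewrite /value big_ord_recr. Qed.

Lemma digit_le2 (a : 'Z_3) : (a <= 2)%N.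
Proof. by case: a => -[|[|[|//]]]. Qed.

Lemma value_lt q y : (value q y < 3 ^ q)%N.
Proof.
elim: q => [|q IH]; first by rewrite /value big_ord0.
rewrite valueS expnS; have := digit_le2 (y q); nia.
Qed.

Lemma value_agree q y y' : agree q y y' -> value q y = value q y'.
Proof. by move=> h; apply: eq_bigr => i _; rewrite h. Qed.

Lemma value_inj q y y' : value q y = value q y' -> agree q y y'.
Proof.
elim: q => [|q IH]; first by move=> _ i.
rewrite !valueS => h; have h1 := value_lt q y; have h2 := value_lt q y'.
have e : y q = y' q.
  apply: val_inj => /=; have : (3 ^ q > 0)%N by rewrite expn_gt0.
  nia.
have a : agree q y y' by apply: IH; move: h; rewrite e; lia.
by move=> i; rewrite ltnS leq_eqVlt => /orP[/eqP->//|]; exact: a.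
Qed.

(** Reduction modulo 3^q is kept as an exact identity in the naturals: the second summand is the
    overflow, present when all [q] digits are 2. *)
Lemma value_odo q y : (value q (odo y) + 3 ^ q * full q y)%N = (value q y + 1)%N.
Proof.
elim: q => [|q IH]; first by rewrite /value !big_ord0.
rewrite !valueS fullS [odo y q]/odo; case: (full q y) IH => IH; last first.
  by rewrite mulr0n addr0 andFb !muln0 in IH *; lia.
rewrite mulr1n; rewrite muln1 in IH; rewrite expnS.
case: (y q) => -[|[|[|//]]] hi /=.
- by set m := ((_ + _) %% _)%N; have -> : m = 1%N by []; lia.
- by set m := ((_ + _) %% _)%N; have -> : m = 2%N by []; lia.
- by set m := ((_ + _) %% _)%N; have -> : m = 0%N by []; lia.

Qed.

Lemma value_iter_odo q n y : value q (iter n odo y) = ((value q y + n) %% 3 ^ q)%N.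
Proof.
elim: n => [|n IH]; first by rewrite addn0 modn_small ?value_lt.
rewrite iterS; have := value_odo q (iter n odo y); rewrite IH => h.
have l := value_lt q (odo (iter n odo y)).
rewrite addnS -addn1 -modnDml -h.
by rewrite -[RHS]modn_mod addnC mulnC modnMDl modn_mod modn_small.
Qed.

Lemma value_iter_odo_small q n y : (value q y + n < 3 ^ q)%N ->
  value q (iter n odo y) = (value q y + n)%N.
Proof. by move=> h; rewrite value_iter_odo modn_small. Qed.

(** The time is the difference of the two residues, with 3^q added to keep the subtraction
    nonnegative. It makes the cylinders of length [q] translates of one another. *)
Lemma agree_odo_iter q c c' :
  exists n, forall y, agree q y c <-> agree q (iter n odo y) c'.
Proof.
exists (value q c' + 3 ^ q - value q c)%N => y.
have h1 := value_lt q c; have h2 := value_lt q c'; have h3 := value_lt q y.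
split=> [h|/value_agree].
  apply: value_inj; rewrite value_iter_odo (value_agree h).
  have -> : (value q c + (value q c' + 3 ^ q - value q c) = value q c' + 3 ^ q)%N by lia.
  by rewrite modnDr modn_small.
rewrite value_iter_odo => h; apply: value_inj.
have : (value q y + (value q c' + 3 ^ q - value q c) + value q c
    = value q c' + value q c %[mod 3 ^ q])%N.
  by rewrite -[LHS]modnDml h.
have -> : (value q y + (value q c' + 3 ^ q - value q c) + value q c
   = value q c' + value q y + 3 ^ q)%N by lia.
rewrite modnDr => /eqP; rewrite eqn_modDl => /eqP.
by rewrite !modn_small.
Qed.

(** The position where the carry of adding one stops. The all-2 sequence, where it never stops, gets
    the default 0. *)
Definition lead (y : digits) : nat :=
  if pselect (exists i, y i != 2) is left e then ex_minn e else 0.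

Lemma lead_eq y k : full k y -> y k != 2 -> lead y = k.
Proof.
move=> /fullP fk yk; rewrite /lead; case: pselect => [e|]; last by case; exists k.
case: ex_minnP => m ym mmin; apply/eqP; rewrite eqn_leq mmin //=.
by rewrite leqNgt; apply/negP => /fk e'; rewrite e' in ym.
Qed.

Lemma leadP y i : y i != 2 -> (lead y <= i)%N /\ full (lead y) y /\ y (lead y) != 2.
Proof.
move=> yi; rewrite /lead; case: pselect => [e|]; last by case; exists i.
case: ex_minnP => m ym mmin; split; first exact: mmin.
split => //; apply/fullP => j jm; apply/eqP/negPn/negP => /mmin.
by rewrite leqNgt jm.
Qed.

(** * The fibre maps *)

Definition short (q0 : nat) (f : digits -> digits) : Prop :=
  forall q x x', (q0 <= q)%N -> agree q x x' -> agree q (f x) (f x').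

(** Such a bijection permutes the cylinders of each length at least [q0], which is why it preserves
    the uniform measure. *)
Definition rigid (q0 : nat) (f : digits -> digits) : Prop :=
  short q0 f /\ exists2 g, short q0 g & cancel f g /\ cancel g f.

Lemma short_leq q r f : (q <= r)%N -> short q f -> short r f.
Proof. by move=> qr h s x x' rs; apply: h; exact: leq_trans rs. Qed.

Lemma rigid_leq q r f : (q <= r)%N -> rigid q f -> rigid r f.
Proof.
move=> qr [sf [g sg fg]]; split; first exact: short_leq sf.
by exists g => //; exact: short_leq sg.
Qed.

Lemma rigid_id q : rigid q id.
Proof. by split => //; exists id. Qed.

Lemma rigid_comp q f g : rigid q f -> rigid q g -> rigid q (f \o g).
Proof.
move=> [sf [f' sf' [ff' f'f]]] [sg [g' sg' [gg' g'g]]]; split.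
  by move=> r x x' qr h; apply: (sf) => //; exact: sg.
exists (g' \o f'); last by split; [exact: can_comp|exact: can_comp].
by move=> r x x' qr h; apply: (sg') => //; exact: sf'.
Qed.

Lemma rigid_iter q n f : rigid q f -> rigid q (iter n f).
Proof.
move=> rf; elim: n => [|n IH]; first exact: rigid_id.
exact: (rigid_comp rf IH).
Qed.

Lemma level_preimage q0 q f A : short q0 f -> (q0 <= q)%N ->
  level q A -> level q (f @^-1` A).
Proof. by move=> sf qq lA x x' h; apply: lA; exact: sf. Qed.

(* On the first two blocks of [2 ^ m] digits, [spin m] is the map
   (a, b) |-> (b, - a - b), of order 3. *)
Definition spin (m : nat) (x : digits) : digits := fun i =>
  if (i < 2 ^ m)%N then x (i + 2 ^ m)%N
  else if (i < 2 ^ m.+1)%N then - x (i - 2 ^ m)%N - x i else x i.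

Fixpoint spins (k : nat) (x : digits) : digits :=
  if k is m.+1 then spin m (spins m x) else x.

Fixpoint spins_inv (k : nat) (x : digits) : digits :=
  if k is m.+1 then spins_inv m (spin m (spin m x)) else x.

(** The outermost factor is the power of [spin 0] and the innermost that of the highest digit,
    whereas [spins] applies [spin 0] first. Composed after [mix], [spins] can thus cancel its powers
    one by one from the outside. *)
Fixpoint mix (p : nat) (y x : digits) : digits :=
  if p is m.+1 then mix m y (iter (y m) (spin m) x) else x.

Lemma spin_low m x i : (i < 2 ^ m)%N -> spin m x i = x (i + 2 ^ m)%N.
Proof. by move=> h; rewrite /spin h. Qed.

Lemma spin_mid m x i : (i < 2 ^ m)%N ->
  spin m x (i + 2 ^ m)%N = - x i - x (i + 2 ^ m)%N.
Proof.
move=> h; rewrite /spin ltnNge leq_addl /= expnS mul2n -addnn ltn_add2r h.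
by rewrite addnK.
Qed.

Lemma spin_high m x i : (2 ^ m.+1 <= i)%N -> spin m x i = x i.
Proof.
move=> h; rewrite /spin !ltnNge h (leq_trans _ h) //.
by rewrite leq_exp2l.
Qed.

Lemma spin_split m (Q : nat -> Prop) :
  (forall i, (i < 2 ^ m)%N -> Q i) ->
  (forall i, (i < 2 ^ m)%N -> Q (i + 2 ^ m)%N) ->
  (forall i, (2 ^ m.+1 <= i)%N -> Q i) -> forall i, Q i.
Proof.
move=> h1 h2 h3 i; case: (ltnP i (2 ^ m)) => [/h1//|il].
case: (ltnP i (2 ^ m.+1)) => [iu|/h3//].
rewrite -(subnK il); apply: h2; move: iu; rewrite expnS; lia.
Qed.

Lemma rotate_low (V : comNzRingType) (a b : V) : - b - (- a - b) = a.
Proof. ring. Qed.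

Lemma rotate_mid (V : comNzRingType) (a b : V) : - (- a - b) - (- b - (- a - b)) = b.
Proof. ring. Qed.

Lemma spin3 m x : spin m (spin m (spin m x)) = x.
Proof.
apply/funext; apply: (@spin_split m) => i h.
- rewrite spin_low // spin_mid // spin_low // spin_mid //. exact: rotate_low.
- rewrite !spin_mid // !(spin_low (spin _ _)) // ?spin_mid // ?spin_low //.
  exact: rotate_mid.
- by rewrite !spin_high.
Qed.

Lemma short_spin m : short (2 ^ m.+1) (spin m).
Proof.
move=> q x x' mq h; apply: (@spin_split m) => i im iq.
- by rewrite !spin_low // h //; move: mq; rewrite expnS; lia.
- by rewrite !spin_mid // !h //; move: mq; rewrite expnS; lia.
- by rewrite !spin_high // h.
Qed.

Lemma rigid_spin m : rigid (2 ^ m.+1) (spin m).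
Proof.
split; first exact: short_spin.
exists (spin m \o spin m); last by split => x; exact: spin3.
by move=> q x x' mq h; do 2 apply: short_spin => //.
Qed.

Lemma rigid_spins k : rigid (2 ^ k) (spins k).
Proof.
elim: k => [|k IH]; first exact: rigid_id.
apply: (@rigid_comp _ (spin k) (spins k)); first exact: rigid_spin.
by apply: rigid_leq IH; rewrite leq_exp2l.
Qed.

Lemma spinsK k : cancel (spins k) (spins_inv k).
Proof. by elim: k => // k IH x /=; rewrite spin3 IH. Qed.

Lemma spins_invK k : cancel (spins_inv k) (spins k).
Proof. by elim: k => // k IH x /=; rewrite IH spin3. Qed.

Lemma short_spins_inv k : short (2 ^ k) (spins_inv k).
Proof.
elim: k => [|k IH] q x x' kq h //=.
have kq' : (2 ^ k <= q)%N by apply: leq_trans kq; rewrite leq_exp2l.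
by apply: IH => //; do 2 apply: short_spin => //.
Qed.

Lemma mix_agree p y y' : agree p y y' -> mix p y = mix p y'.
Proof.
elim: p => // p IH h; apply/funext => x /=.
by rewrite h // IH //; exact: agree_leq h.
Qed.

Lemma rigid_mix p y : rigid (2 ^ p) (mix p y).
Proof.
elim: p => [|p IH]; first exact: rigid_id.
apply: (@rigid_comp _ (mix p y) (iter (y p) (spin p))).
  by apply: rigid_leq IH; rewrite leq_exp2l.
exact/rigid_iter/rigid_spin.
Qed.

Lemma mix_surj p y x : exists z, x = mix p y z.
Proof. by case: (rigid_mix p y) => _ [g _ [_ gK]]; exists (g x); rewrite gK. Qed.

(** A digit 2 contributes a square, which one more [spin] turns into a cube, the identity. *)
Lemma spins_mix_full p y x : full p y -> spins p (mix p y x) = x.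
Proof.
elim: p x => // p IH x; rewrite fullS => /andP[fp /eqP yp] /=.
by rewrite yp IH //= spin3.
Qed.

Lemma mix0 p y x : (forall i, (i < p)%N -> y i = 0) -> mix p y x = x.
Proof.
by elim: p x => // p IH x h /=; rewrite h //= IH // => i ip; rewrite h // ltnW.
Qed.

Lemma mixS p y x : mix p.+1 y x = mix p y (iter (y p) (spin p) x).
Proof. by []. Qed.

(** The cocycle identity behind the coordinate z: the digits 2 below [lead y] become 0 and their
    squares cancel, the digit at [lead y] gains one power, and [odo] leaves the higher digits
    alone. *)
Lemma spins_mix p y x : ~~ full p y ->
  spins (lead y).+1 (mix p y x) = mix p (odo y) x.
Proof.
elim: p x => // p IH x; rewrite fullS negb_and => nf.
case fp: (full p y) nf => yp; rewrite !mixS; last first.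
  have -> : odo y p = y p by rewrite /odo fp addr0.
  by apply: IH; rewrite fp.
rewrite (lead_eq fp yp) [LHS]/= spins_mix_full // mix0; last first.
  move=> i ip; rewrite /odo.
  have -> : full i y.
    by apply/fullP => j ji; move/fullP: fp; apply; exact: ltn_trans ip.
  by rewrite (elimT (fullP _ _) fp) //; apply/eqP.
by rewrite /odo fp; case: (y p) yp => -[|[|[|//]]].
Qed.

Definition skew (f : digits -> digits) (k : digits -> nat)
    (V : nat -> digits -> digits) (yx : digits * digits) : digits * digits :=
  (f yx.1, V (k yx.1) yx.2).

Definition tower : digits * digits -> digits * digits :=
  skew odo (fun y => (lead y).+1) spins.

Definition tower_inv : digits * digits -> digits * digits :=
  skew odo_inv (fun y => (lead (odo_inv y)).+1) spins_inv.

Lemma towerK : cancel tower tower_inv.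
Proof. by move=> [y x]; rewrite /tower_inv /tower /skew /= odoK spin3 spinsK. Qed.

Lemma tower_invK : cancel tower_inv tower.
Proof.
by move=> [y x]; rewrite /tower_inv /tower /skew /= odo_invK spins_invK spin3.
Qed.

(** The bound keeps the [n] additions from carrying out of the first [p] digits, so [spins_mix]
    applies at every step and the point inside [mix p] does not move. *)
Lemma iter_tower p n y x : (value p y + n < 3 ^ p)%N ->
  iter n tower (y, mix p y x) = (iter n odo y, mix p (iter n odo y) x).
Proof.
elim: n => // n IH h; rewrite !iterS IH; last by apply: leq_ltn_trans h; lia.
rewrite [LHS]/tower/skew; congr pair; apply: spins_mix.
(* A full iterate would have value 3^p - 1, leaving no room for the next addition. *)
apply/negP => f; have := value_odo p (iter n odo y); rewrite f.
by rewrite value_iter_odo_small; lia.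
Qed.

(** Digit [i] is at most 1, so the value is below 2 * 3^i, and n <= i < 3^i. *)
Lemma exists_value n i y : (n <= i)%N -> y i != 2 ->
  (value i.+1 y + n < 3 ^ i.+1)%N.
Proof.
move=> ni yi; rewrite valueS expnS.
have : (y i <= 1)%N by case: (y i) yi => -[|[|[|//]]].
by have := value_lt i y; have := @ltn_expl 3 i isT; nia.
Qed.

(** * A linear relation along the orbits of [spin] *)

Definition zero_sum (q : nat) (a b c : digits) : Prop :=
  forall i, (i < q)%N -> a i + b i + c i = 0.

Lemma rotate_sum (V : comNzRingType) (a b c a' b' c' : V) :
  (- a - a') + (- b - b') + (- c - c') = - ((a + b + c) + (a' + b' + c')).
Proof. ring. Qed.

(** [spin m] is linear in the digits, and it keeps the first [q] of them among themselves once they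
    contain both of its blocks. *)
Lemma zero_sum_spin m q a b c : (2 ^ m.+1 <= q)%N ->
  zero_sum q a b c -> zero_sum q (spin m a) (spin m b) (spin m c).
Proof.
move=> mq h; apply: (@spin_split m (fun i => (i < q)%N ->
  spin m a i + spin m b i + spin m c i = 0)) => i im iq.
- by rewrite !spin_low // h //; move: mq; rewrite expnS; lia.
- rewrite !spin_mid //.
  have := h i; have := h _ iq => h1 h2.
  have {}h2 : a i + b i + c i = 0 by apply: h2; lia.
  by rewrite rotate_sum h1 h2 addr0 oppr0.
- by rewrite !spin_high // h.
Qed.

Lemma zero_sum_mix p q y a b c : (2 ^ p <= q)%N ->
  zero_sum q a b c -> zero_sum q (mix p y a) (mix p y b) (mix p y c).
Proof.
elim: p a b c => // p IH a b c pq h /=; apply: IH.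
  by apply: leq_trans pq; rewrite leq_exp2l.
by elim: (y p : nat) => //= n IHn; exact: zero_sum_spin.
Qed.

(** The first blocks of the three points are a, b and - a - b. *)
Lemma zero_sum_orbit m x : zero_sum (2 ^ m) x (spin m x) (spin m (spin m x)).
Proof.
move=> i im; rewrite (spin_low x) // (spin_low (spin m x)) // spin_mid //.
by rewrite -opprD addrN.
Qed.

(** Adding [d] at position [m], where the digit is 0, produces no carry. *)
Lemma iter_odo_digit m y d : (d <= 2)%N -> y m = 0 ->
  agree m (iter (d * 3 ^ m) odo y) y /\
  nat_of_ord (iter (d * 3 ^ m) odo y m) = d.
Proof.
move=> d2 ym.
have e : value m (iter (d * 3 ^ m) odo y) = value m y.
  by rewrite value_iter_odo addnC modnMDl modn_small // value_lt.
split; first exact: value_inj.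
have := @value_iter_odo_small m.+1 (d * 3 ^ m) y.
rewrite !valueS e ym mul0n addn0 => h.
have l := value_lt m y.
have : (0 < 3 ^ m)%N by rewrite expn_gt0.
have {}h := h ltac:(rewrite expnS; nia).
by nia.
Qed.

(* Times 0, 3^m and 2 * 3^m see the three points of an orbit of [spin m],
   which are pairwise but not jointly independent. *)
Lemma tower_zero_sum m (y x : digits) : y m = 0 ->
  x 0%N + (iter (3 ^ m) tower (y, x)).2 0%N
    + (iter (2 * 3 ^ m) tower (y, x)).2 0%N = 0.
Proof.
move=> ym; case: (mix_surj m.+1 y x) => z ->.
have l := value_lt m y.
(* At time d * 3^m the lower digits are back to those of [y] and digit [m] is [d], so only the
   innermost power in [mix] changes. *)
have it d : (d <= 2)%N -> (iter (d * 3 ^ m) tower (y, mix m.+1 y z)).2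
    = mix m y (iter d (spin m) z).
  move=> d2; rewrite iter_tower /=; last by rewrite valueS ym expnS mul0n; nia.
  have [a ->] := iter_odo_digit d2 ym.
  by rewrite (mix_agree a).
rewrite -{1}(mul1n (3 ^ m)%N) !it //= ym /=.
by apply: (@zero_sum_mix m (2 ^ m)) => //; [exact: zero_sum_orbit|rewrite expn_gt0].
Qed.

(** * The uniform measure on sequences of digits *)

Definition cyl (q : nat) (c : digits) : set digits := [set y | agree q y c].

Definition cylinders : set (set digits) := [set A | exists q c, A = cyl q c].

HB.instance Definition _ := gen_eqMixin digits.
HB.instance Definition _ := gen_choiceMixin digits.
HB.instance Definition _ := isPointed.Build digits (fun=> 0).
HB.instance Definition _ := Measurable.copy digits (g_sigma_algebraType cylinders).

Lemma measurable_cyl q c : measurable (cyl q c).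
Proof. by apply: sub_sigma_algebra; exists q, c. Qed.

Lemma cyl0 c : cyl 0 c = setT.
Proof. by apply/seteqP; split. Qed.

(** The index type is finite, hence countable, and each piece is empty or a cylinder by
    [level_piece]; this gives measurability of [A]. *)
Lemma level_bigcup q A : level q A ->
  A = \bigcup_(c : {ffun 'I_q -> 'Z_3})
    [set y | A y /\ forall i : 'I_q, y i = c i].
Proof.
move=> lA; apply/seteqP; split=> [y Ay|y [c _ []//]].
by exists [ffun i : 'I_q => y i] => //; split => // i; rewrite ffunE.
Qed.

Lemma level_piece q A (c : 'I_q -> 'Z_3) : level q A ->
  [set y | A y /\ forall i : 'I_q, y i = c i] = set0 \/
  exists y, [set y | A y /\ forall i : 'I_q, y i = c i] = cyl q y.
Proof.
move=> lA; have [[y [Ay yc]]|n] := pselect (exists y, A y /\ forall i : 'I_q, y i = c i).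
  right; exists y; apply/seteqP; split=> [z [Az zc] i iq|z zy].
    by rewrite (zc (Ordinal iq)) (yc (Ordinal iq)).
  by split=> [|i]; [apply: lA Ay; exact: agree_sym|rewrite zy // yc].
by left; rewrite -subset0 => z h; apply: n; exists z.
Qed.

Lemma measurable_level q A : level q A -> measurable A.
Proof.
move=> lA; rewrite (level_bigcup lA); apply: countable_bigcupT_measurable => [//|c].
by have [->|[y ->]] := level_piece c lA; [exact: measurable0|exact: measurable_cyl].
Qed.

Lemma level_cyl q c : level q (cyl q c).
Proof. by move=> x x' h hx; apply: agree_trans hx; exact: agree_sym. Qed.

Lemma measurable_short q f : short q f -> measurable_fun setT f.
Proof.
move=> sf; apply: (@measurability _ _ _ _ _ _ cylinders) => //.
move=> _ [_ [r [c ->]] <-]; rewrite setTI.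
apply: (@measurable_level (maxn q r)); apply: (level_preimage sf).
  exact: leq_maxl.
by apply: level_leq (@level_cyl r c); exact: leq_maxr.
Qed.

Lemma cyl_setI q r c c' : (q <= r)%N ->
  cyl q c `&` cyl r c' = cyl r c' \/ cyl q c `&` cyl r c' = set0.
Proof.
move=> qr; have [h|h] := pselect (agree q c c'); [left|right].
  apply: setIidr => y yc'; apply: agree_trans (agree_sym h).
  exact: agree_leq yc'.
rewrite -subset0 => y [yc yc']; apply: h; apply: agree_trans (agree_leq qr yc').
exact: agree_sym.
Qed.

(** The cylinders of length at least [q], with the empty and the full set, form a pi-system that
    generates all cylinders. Short ones are left out because a rigid map is controlled only on long
    ones. *)
Lemma cyl_measure_unique (R : realType) (q : nat)
    (m1 m2 : {measure set digits -> \bar R}) :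
  m1 setT = m2 setT -> (m1 setT < +oo)%E ->
  (forall r c, (q <= r)%N -> m1 (cyl r c) = m2 (cyl r c)) ->
  forall A, measurable A -> m1 A = m2 A.
Proof.
move=> eT fT eC A mA.
pose G := [set B : set digits |
  B = set0 \/ B = setT \/ exists r c, (q <= r)%N /\ B = cyl r c].
apply: (@g_sigma_algebra_measure_unique _ R digits G _ (fun=> setT)) => //.
- by move=> _ [->//|[->//|[r [c [_ ->]]]]]; exact: measurable_cyl.
- by move=> _; right; left.
- by rewrite bigcup_const.
- move=> B C [->|[->|[r [c [qr ->]]]]]; first by rewrite set0I; left.
    by rewrite setTI.
  move=> [->|[->|[s [d [qs ->]]]]]; first by rewrite setI0; left.
    by rewrite setIT; right; right; exists r, c.
  case/orP: (leq_total r s) => rs.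
    by have [->|->] := cyl_setI c d rs; [right; right; exists s, d|left].
  by rewrite setIC; have [->|->] := cyl_setI d c rs; [right; right; exists r, c|left].
- move=> B [->|[->//|[r [c [qr ->]]]]]; first by rewrite !measure0.
  exact: eC.
- apply: (smallest_sub _ _ mA); first exact: smallest_sigma_algebra.
  move=> _ [r [c ->]].
  have lv : level (maxn q r) (cyl r c).
    by apply: level_leq (@level_cyl r c); exact: leq_maxr.
  rewrite (level_bigcup lv).
  apply: (@countable_bigcupT_measurable _ (g_sigma_algebraType G)) => // d.
  have [->|[y ->]] := level_piece d lv; first exact: sigma_algebra0.
  by apply: sub_sigma_algebra; right; right; exists (maxn q r), y; rewrite leq_maxl.
Qed.

(** * Construction from Lebesgue measure by ternary expansion *)

Section uniform.
Variable R : realType.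

(** The ternary expansion, most significant digit first; [inZp] reduces the truncation modulo 3.
    Outside [0, 1), which [unit_measure] does not charge, the default is the zero sequence. *)
Definition ternary (t : R) : digits := fun i =>
  if (0 <= t < 1) then inZp (Num.truncn (t * 3 ^+ i.+1)) else 0.

(** The number of the triadic interval of length 3^-q that corresponds to the first [q] digits. *)
Fixpoint msb (q : nat) (y : digits) : nat :=
  if q is p.+1 then (3 * msb p y + y p)%N else 0%N.

Lemma msb_agree q y y' : agree q y y' -> msb q y = msb q y'.
Proof. by elim: q => //= q IH h; rewrite IH ?h //; exact: agree_leq h. Qed.

Lemma msb_inj q y y' : msb q y = msb q y' -> agree q y y'.
Proof.
elim: q => [_ i //|q IH /= h].
have := digit_le2 (y q); have := digit_le2 (y' q) => h1 h2.
have e : y q = y' q by apply: val_inj => /=; lia.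
have a : agree q y y' by apply: IH; lia.
by move=> i; rewrite ltnS leq_eqVlt => /orP[/eqP->//|]; exact: a.
Qed.

Lemma msb_lt q y : (msb q y < 3 ^ q)%N.
Proof. by elim: q => //= q IH; rewrite expnS; have := digit_le2 (y q); lia. Qed.

Lemma truncn_mul3 (x : R) : 0 <= x ->
  Num.truncn (x * 3) = (3 * Num.truncn x + Num.truncn (x * 3) %% 3)%N.
Proof.
move=> x0; have x30 : 0 <= x * 3 by rewrite mulr_ge0.
have /andP[l1 u1] := truncn_itv x30; have /andP[l2 u2] := truncn_itv x0.
set n := Num.truncn (x * 3) in l1 u1 *; set m := Num.truncn x in l2 u2 *.
have h1 : (3 * m <= n)%N.
  rewrite truncn_ge_nat // natrM; lra.
have h2 : (n < 3 * m.+1)%N.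
  by rewrite truncn_lt_nat // natrM; lra.
lia.
Qed.

Lemma msb_ternary q (t : R) : 0 <= t < 1 ->
  msb q (ternary t) = Num.truncn (t * 3 ^+ q).
Proof.
move=> t01; have /andP[t0 t1] := t01.
elim: q => [|q IH] /=.
  by rewrite expr0 mulr1; apply/esym/truncn_def; rewrite t0.
rewrite IH exprSr mulrA [RHS]truncn_mul3 ?mulr_ge0 ?exprn_ge0 //.
by rewrite /ternary t01 /= exprSr mulrA.
Qed.

Lemma ternary_cyl q c (t : R) : 0 <= t < 1 ->
  cyl q c (ternary t) <->
  (msb q c)%:R / 3 ^+ q <= t < (msb q c).+1%:R / 3 ^+ q.
Proof.
move=> t01; have /andP[t0 t1] := t01.
have p : (0 : R) < 3 ^+ q by rewrite exprn_gt0.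
have -> : ((msb q c)%:R / 3 ^+ q <= t < (msb q c).+1%:R / 3 ^+ q)
  = (Num.truncn (t * 3 ^+ q) == msb q c).
  by rewrite truncn_eq ?mulr_ge0 ?(ltW p) // ler_pdivrMr // ltr_pdivlMr.
rewrite -(msb_ternary q t01); split=> [/msb_agree->//|/eqP].
exact: msb_inj.
Qed.

Lemma ternary_cylE q c :
  `[0, 1[ `&` ternary @^-1` cyl q c =
  `[(msb q c)%:R / 3 ^+ q, (msb q c).+1%:R / 3 ^+ q[%classic :> set R.
Proof.
have p : (0 : R) < 3 ^+ q by rewrite exprn_gt0.
apply/seteqP; split=> t /=; rewrite !in_itv /=.
  by move=> [h /(ternary_cyl _ _ h)].
move=> h.
have t01 : 0 <= t < 1.
  move: h => /andP[h1 h2]; apply/andP; split.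
    by apply: le_trans h1; rewrite divr_ge0 // ltW.
  apply: lt_le_trans h2 _; rewrite ler_pdivrMr // mul1r -natrX ler_nat.
  exact: msb_lt.
by split => //; apply/ternary_cyl.
Qed.

Lemma measurable_ternary : measurable_fun setT (ternary : measurableTypeR R -> digits).
Proof.
apply: (@measurability _ _ _ _ _ _ cylinders) => //.
move=> _ [_ [q [c ->]] <-]; rewrite setTI.
rewrite -(setIT (_ @^-1` _)) -(setUv `[0, 1[) setIUr; apply: measurableU.
  by rewrite setIC ternary_cylE; exact: measurable_itv.
(* Outside [0, 1) the map is constantly the zero sequence, so the preimage there is everything or
   nothing. *)
have [h|h] := pselect (cyl q c (fun=> 0)); last first.
  rewrite (_ : _ `&` _ = set0) // -subset0 => t [/= ht /negP].
  by rewrite in_itv /= => /negbTE n; apply: h; rewrite /ternary n in ht.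
rewrite setIidr; first by apply: measurableC; exact: measurable_itv.
by move=> t /= /negP; rewrite in_itv /= /ternary => /negbTE ->.
Qed.

Definition unit_measure : {measure set (measurableTypeR R) -> \bar R} :=
  mrestr (@lebesgue_measure R) (@measurable_itv R `[0%R, 1%R[).

Definition unif : set digits -> \bar R := pushforward unit_measure ternary.

HB.instance Definition _ := Measure.copy unif
  (measure_function_pushforward__canonical__measure_function_Measure
    unit_measure measurable_ternary).

Lemma unif_cyl q c : unif (cyl q c) = (3 ^- q)%:E.
Proof.
rewrite /unif /pushforward /= /mrestr setIC ternary_cylE lebesgue_measure_itv /=.
have p : (0 : R) < 3 ^+ q by rewrite exprn_gt0.
rewrite lte_fin ltr_pM2r ?invr_gt0 // ltr_nat ltnSn -EFinB -mulrBl.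
by rewrite -natr1 addrAC subrr add0r mul1r.
Qed.

Lemma unif_setT : unif setT = 1%E.
Proof. by rewrite -(cyl0 (fun=> 0)) unif_cyl expr0 invr1. Qed.

HB.instance Definition _ :=
  Measure_isProbability.Build _ _ R unif unif_setT.

End uniform.

(** * Invariance and independence for the uniform measure *)

Section uniform_theory.
Variable R : realType.
Local Notation P := (@unif R).

(** With [g] the inverse of [f], the preimage of the cylinder of [c] is the cylinder of [g c] of the
    same length, once that length is at least [q]. *)
Lemma unif_rigid q f A : rigid q f -> measurable A -> P (f @^-1` A) = P A.
Proof.
move=> [sf [g sg [fg gf]]] mA.
have mf := measurable_short sf.
pose m : {measure set digits -> \bar R} :=
  measure_function_pushforward__canonical__measure_function_Measure P mf.
apply: (@cyl_measure_unique R q m) => //.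
- by rewrite /m /= /pushforward preimage_setT probability_setT ltry.
- move=> r c qr; rewrite /m /= /pushforward.
  suff -> : f @^-1` cyl r c = cyl r (g c) by rewrite !unif_cyl.
  apply/seteqP; split=> y /= h.
    by rewrite -(fg y); exact: sg.
  by rewrite -(gf c); exact: sf.
Qed.

Definition shift (q : nat) (x : digits) : digits := fun i => x (i + q)%N.

Definition merge (q : nat) (ab : digits * digits) : digits := fun i =>
  if (i < q)%N then ab.1 i else ab.2 (i - q)%N.

Lemma merge_cyl q r c :
  merge q @^-1` cyl r c = cyl (minn q r) c `*` cyl (r - q) (shift q c).
Proof.
apply/seteqP; split=> [[a b] /= h|[a b] [/= h1 h2] i ir].
  split=> i ir /=.
    by move: ir; rewrite leq_min => /andP[iq ir]; rewrite -(h i ir) /merge /= iq.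
  by rewrite /shift -(h (i + q)%N) ?/merge /= 1?ltnNge ?leq_addl /= ?addnK //; lia.
rewrite /merge /=; case: ifP => iq; first by apply: h1; rewrite leq_min iq.
by rewrite h2 ?/shift ?subnK //; lia.
Qed.

Lemma measurable_merge q : measurable_fun setT (merge q).
Proof.
apply: (@measurability _ _ _ _ _ _ cylinders) => //.
move=> _ [_ [r [c ->]] <-]; rewrite setTI merge_cyl.
by apply: measurableX; exact: measurable_cyl.
Qed.

(** Independence of the first [q] digits from the rest: [merge q] carries the product measure to
    [P], since cylinders pull back to rectangles. *)
Lemma unif_shift q C D : level q C -> measurable D ->
  P (C `&` shift q @^-1` D) = (P C * P D)%E.
Proof.
move=> lC mD; have mC := measurable_level lC.
have mmg := @measurable_merge q.
pose PP : {measure set (digits * digits) -> \bar R} := (P \x P)%E.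
pose m : {measure set digits -> \bar R} :=
  measure_function_pushforward__canonical__measure_function_Measure PP mmg.
have PPT : PP setT = 1%E.
  by rewrite -setXTT /PP /= product_measure1E //= unif_setT mule1.
have mE : forall A, measurable A -> m A = P A.
  have mT : m setT = 1%E by rewrite /m /= /pushforward preimage_setT PPT.
  apply: (@cyl_measure_unique R q m P); rewrite ?mT ?ltry //=; first by rewrite unif_setT.
  move=> r c qr; rewrite /m /= /pushforward merge_cyl /PP /=.
  rewrite product_measure1E; try exact: measurable_cyl.
  rewrite /= !unif_cyl -EFinM -invfM -exprD; congr (_ ^- _)%:E; lia.
have ms : measurable (shift q @^-1` D).
  have sh : measurable_fun setT (shift q).
    apply: (@measurability _ _ _ _ _ _ cylinders) => //.
    move=> _ [_ [r [c ->]] <-]; rewrite setTI.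
    apply: (@measurable_level (r + q)) => x x' xx' h i ir.
    by rewrite -h // /shift xx' // ltn_add2r.
  by rewrite -[X in measurable X]setTI; exact: sh.
rewrite -mE; last exact: measurableI.
rewrite /m /= /pushforward -product_measure1E //; congr (PP _).
apply/seteqP; split=> [[a b] /= [h1 h2]|[a b] /= [h1 h2]].
  split.
    by apply: lC h1 => i iq; rewrite /merge iq.
  move: h2; congr (D _); apply/funext => i.
  by rewrite /shift /merge /= ltnNge leq_addl /= addnK.
split.
  by apply: lC h1 => i iq; rewrite /merge iq.
move: h2; congr (D _); apply/funext => i.
by rewrite /shift /merge /= ltnNge leq_addl /= addnK.
Qed.

(** The first block after [spin m] is the old second block, so the two events read disjoint sets of
    digits. *)
Lemma unif_spin1 m C D : level (2 ^ m) C -> level (2 ^ m) D ->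
  P [set w | C w /\ D (spin m w)] = (P C * P D)%E.
Proof.
move=> lC lD; rewrite -(unif_shift lC (measurable_level lD)).
congr (P _); apply/seteqP; split=> w /= [Cw Dw]; split => //;
  by apply: lD Dw => i im; rewrite /shift spin_low.
Qed.

Lemma level_iter_spin m n q A : (2 ^ m.+1 <= q)%N -> level q A ->
  level q (iter n (spin m) @^-1` A).
Proof.
move=> mq lA; apply: (level_preimage _ mq lA).
by have [] := rigid_iter n (rigid_spin m).
Qed.

Lemma unif_spin m (a b : nat) C D : (a <= 2)%N -> (b <= 2)%N -> a <> b ->
  level (2 ^ m) C -> level (2 ^ m) D ->
  P [set w | C (iter a (spin m) w) /\ D (iter b (spin m) w)] = (P C * P D)%E.
Proof.
move=> a2 b2 ab lC lD.
have lL A : level (2 ^ m) A -> level (2 ^ m.+1) A.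
  by apply: level_leq; rewrite leq_exp2l.
have mset c d : measurable [set w | C (iter c (spin m) w) /\ D (iter d (spin m) w)].
  apply: (@measurable_level (2 ^ m.+1)) => x x' h [Cx Dx]; split.
    exact: (level_iter_spin (leqnn _) (lL _ lC)) h Cx.
  exact: (level_iter_spin (leqnn _) (lL _ lD)) h Dx.
have r1 := rigid_spin m; have r2 := rigid_iter 2 r1.
have e0 : P [set w | C (iter 0 (spin m) w) /\ D (iter 1 (spin m) w)] = (P C * P D)%E.
  exact: unif_spin1.
have e1 : P [set w | C (iter 1 (spin m) w) /\ D (iter 0 (spin m) w)] = (P C * P D)%E.
  rewrite muleC -(unif_spin1 lD lC); congr (P _); apply/seteqP; by split=> w /= [].
(* Exponents count modulo 3, so a further power of [spin m], which preserves [P], moves each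
   remaining pair to (0, 1) or (1, 0). *)
case: a b a2 b2 ab => [|[|[|//]]] [|[|[|//]]] _ _ // _.
- rewrite -(unif_rigid r1) // -e1; congr (P _).
  by apply/seteqP; split=> w /=; rewrite spin3.
- rewrite -(unif_rigid r2) // -e0; congr (P _).
  by apply/seteqP; split=> w /=; rewrite !spin3.
- rewrite -(unif_rigid r1) // -e0; congr (P _).
  by apply/seteqP; split=> w /=; rewrite spin3.
- rewrite -(unif_rigid r2) // -e1; congr (P _).
  by apply/seteqP; split=> w /=; rewrite !spin3.
Qed.

(* At the highest digit where [y] and [y'] differ, [mix] uses two different
   powers of [spin], which are pairwise independent. *)
Lemma unif_mix l n p y y' C D : (3 ^ l <= n)%N -> value p y' = (value p y + n)%N ->
  level l C -> level l D ->
  P [set z | C (mix p y z) /\ D (mix p y' z)] = (P C * P D)%E.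
Proof.
move=> ln + lC lD; elim: p => [|p IH].
  by rewrite /value !big_ord0; have := expn_gt0 3 l; lia.
move=> e; have {}e : (value p y' + y' p * 3 ^ p = value p y + y p * 3 ^ p + n)%N.
  by rewrite -!valueS.
have mset : measurable [set z | C (mix p y z) /\ D (mix p y' z)].
  have l2 : (l <= maxn l (2 ^ p))%N by exact: leq_maxl.
  have [s _] := rigid_mix p y; have [s' _] := rigid_mix p y'.
  apply: (@measurable_level (maxn l (2 ^ p))) => x x' h [Cx Dx]; split.
    by apply: (level_leq l2 lC) Cx; apply: s h; exact: leq_maxr.
  by apply: (level_leq l2 lD) Dx; apply: s' h; exact: leq_maxr.
(* Equal top digits contribute a common power, removed by invariance of [P]; the gap [n] then
   already occurs in the lower digits. *)
have [yp|yp] := eqVneq (y p) (y' p).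
  have r := rigid_iter (y p) (rigid_spin p).
  rewrite -IH; last by move: e; rewrite yp; lia.
  rewrite -[RHS](unif_rigid r mset); congr (P _); apply/seteqP.
  by split=> z /=; rewrite yp.
(* Values of [p.+1] digits differ by less than 3^(p+1), so a gap of at least 3^l forces l <= p. *)
have lp : (l <= p)%N.
  rewrite leqNgt; apply/negP => pl.
  have := value_lt p y'; have := digit_le2 (y' p).
  have : (3 ^ p.+1 <= 3 ^ l)%N by rewrite leq_exp2l.
  by rewrite expnS; nia.
have lp2 : (l <= 2 ^ p)%N by apply: leq_trans lp _; apply/ltnW/ltn_expl.
have rm := rigid_mix p y; have rm' := rigid_mix p y'.
(* Pulled back through the lower part of [mix], both events still depend only on the first block, of
   2^p digits, as [unif_spin] requires. *)
rewrite -(unif_rigid rm (measurable_level lC)) -(unif_rigid rm' (measurable_level lD)).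
rewrite -(@unif_spin p (y p) (y' p)) //; try exact: digit_le2.
- by move=> h; move/eqP: yp; apply; exact: val_inj.
- by apply: (level_preimage rm.1 (leqnn _)); exact: level_leq lC.
- by apply: (level_preimage rm'.1 (leqnn _)); exact: level_leq lD.
Qed.

Lemma unif_digit0 m : P [set y | y m = 0] = (3^-1)%:E.
Proof.
have := @unif_shift m setT (cyl 1 (fun=> 0)); rewrite unif_cyl probability_setT mul1e.
move=> <- //; last exact: measurable_cyl.
rewrite setTI; congr (P _); apply/seteqP; split=> y /=.
  by move=> ym [|//] _; rewrite /shift.
by move=> /(_ 0%N isT).
Qed.

(** The exceptional base points: elsewhere a digit other than 2 at some position i >= n stops the
    carries of [n] additions, by [exists_value]. *)
Definition eventually2 (n : nat) : set digits :=
  [set y | forall i, (n <= i)%N -> y i = 2].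

Lemma measurable_digit m a : measurable [set y : digits | y m = a].
Proof. by apply: (@measurable_level m.+1) => x x' h /= <-; rewrite h. Qed.

Lemma measurable_eventually2 n : measurable (eventually2 n).
Proof.
rewrite (_ : eventually2 n = \bigcap_(i in [set i | (n <= i)%N]) [set y | y i = 2]) //.
by apply: bigcap_measurable => //; [exists n => /=|move=> i _; exact: measurable_digit].
Qed.

(** For every [q], the [q] digits from position [n] on are all 2, an event of measure 3^-q. *)
Lemma unif_eventually2 n : P (eventually2 n) = 0%E.
Proof.
have h q : (P (eventually2 n) <= (3 ^- q)%:E)%E.
  have := @unif_shift n setT (cyl q (fun=> 2)); rewrite unif_cyl probability_setT mul1e setTI.
  move=> <- //; last exact: measurable_cyl.
  apply: le_measure; rewrite ?inE.
  - exact: measurable_eventually2.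
  - apply: (@measurable_level (n + q)) => x x' xx' /= hx i iq.
    by rewrite /shift -(xx' (i + n)%N) ?(addnC n) ?ltn_add2r //; exact: hx.
  - by move=> y hy i iq; rewrite /shift hy // leq_addl.
apply/eqP; rewrite eq_le measure_ge0 andbT; apply/lee_addgt0Pr => e e0.
rewrite add0e.
have [q qe] : exists q, 3 ^- q < e.
  exists (Num.truncn e^-1).+1; rewrite invf_plt ?posrE ?exprn_gt0 //.
  apply: (@lt_le_trans _ _ (Num.truncn e^-1).+1%:R); first exact: truncnS_gt.
  by rewrite -natrX ler_nat; apply/ltnW/ltn_expl.
by apply: le_trans (h q) _; rewrite lee_fin ltW.
Qed.

End uniform_theory.

(** * The skew product *)

Section odometer_ergodic.
Variable R : realType.
Local Notation P := (@unif R).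

Lemma measurable_odo : measurable_fun setT odo.
Proof. by apply: (@measurable_short 0) => q x x' _; exact: odo_agree. Qed.

Lemma measurable_odo_inv : measurable_fun setT odo_inv.
Proof. by apply: (@measurable_short 0) => q x x' _; exact: odo_inv_agree. Qed.

Lemma unif_odo A : measurable A -> P (odo @^-1` A) = P A.
Proof.
apply: (@unif_rigid R 0); split=> [q x x' _|]; first exact: odo_agree.
exists odo_inv; first by move=> q x x' _; exact: odo_inv_agree.
by split; [exact: odoK|exact: odo_invK].
Qed.

Definition set_digit (q : nat) (a : 'Z_3) (c : digits) : digits :=
  fun i => if i == q then a else c i.

Lemma cyl_split q c : cyl q c =
  cyl q.+1 (set_digit q 0 c) `|` cyl q.+1 (set_digit q 1 c)
    `|` cyl q.+1 (set_digit q 2 c).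
Proof.
apply/seteqP; split=> y /=.
  move=> yc; have h : cyl q.+1 (set_digit q (y q) c) y.
    move=> i; rewrite /set_digit ltnS leq_eqVlt; case: eqP => [->//|_ /=].
    exact: yc.
  have : y q = 0 \/ y q = 1 \/ y q = 2.
    by case: (y q) => -[|[|[|//]]] hi; [left|right; left|right; right]; exact: val_inj.
  by move=> [e|[e|e]]; rewrite e in h; [left; left|left; right|right].
have h a : cyl q.+1 (set_digit q a c) y -> agree q y c.
  move=> yc i iq; rewrite yc ?ltnS 1?ltnW // /set_digit.
  by rewrite ltn_eqF.
by move=> [[]|]; exact: h.
Qed.

Lemma cyl_disjoint q (a b : 'Z_3) c : a != b ->
  cyl q.+1 (set_digit q a c) `&` cyl q.+1 (set_digit q b c) = set0.
Proof.
move=> ab; rewrite -subset0 => y [/(_ q (ltnSn q)) + /(_ q (ltnSn q))].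
by rewrite /set_digit eqxx => -> /eqP; rewrite (negbTE ab).
Qed.

(** Iterates of [odo] move each cylinder of length [q] to any other, so invariance gives them equal
    shares of [A]; splitting a cylinder in three divides the share by 3. *)
Lemma invariant_cyl A : measurable A -> odo @^-1` A = A ->
  forall q c, P (cyl q c `&` A) = (fine (P A) * 3 ^- q)%:E.
Proof.
move=> mA iA.
have same q c c' : P (cyl q c `&` A) = P (cyl q c' `&` A).
  have [n h] := agree_odo_iter q c c'.
  have in_ k : P ((iter k odo) @^-1` (cyl q c' `&` A)) = P (cyl q c' `&` A).
    elim: k => [//|k IH]; rewrite -[RHS]IH -[RHS]unif_odo.
      by congr (P _); apply/funext => y; rewrite /= -iterSr.
    have mk : measurable_fun setT (iter k odo).
      elim: k {IH} => [|k IHk]; first exact: measurable_id.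
      exact: measurableT_comp measurable_odo IHk.
    rewrite -[X in measurable X]setTI; apply: mk => //.
    by apply: measurableI => //; exact: measurable_cyl.
  rewrite -(in_ n); congr (P _); rewrite preimage_setI.
  have -> : iter n odo @^-1` A = A.
    by elim: n {h} => // n IH; rewrite -{2}IH -{2}iA.
  by congr (_ `&` _); apply/seteqP; split=> y /= /h.
have mc q c : measurable (cyl q c `&` A) by apply: measurableI => //; exact: measurable_cyl.
elim=> [|q IH] c.
  by rewrite cyl0 setTI expr0 invr1 mulr1 fineK ?fin_num_measure.
have dj a b : a != b -> (cyl q.+1 (set_digit q a c) `&` A)
    `&` (cyl q.+1 (set_digit q b c) `&` A) = set0.
  by move=> ab; rewrite setIACA cyl_disjoint // set0I.
have := IH c; rewrite cyl_split !setIUl.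
rewrite (measureU _ (measurableU _ _ (mc _ _) (mc _ _)) (mc _ _)); last first.
  by rewrite setIUl !dj // setU0.
rewrite (measureU _ (mc _ _) (mc _ _)); last exact: dj.
rewrite /= (same _ (set_digit q 0 c) c) (same _ (set_digit q 1 c) c) (same _ (set_digit q 2 c) c).
have : P (cyl q.+1 c `&` A) \is a fin_num by exact: fin_num_measure.
case: (P _) => [r| |] //= _; rewrite -!EFinD => -[] e; congr (_%:E).
rewrite exprS invfM; lra.
Qed.

(** By [invariant_cyl], [A] is independent of all cylinders, hence of itself, so its measure equals
    its square. *)
Lemma odo_ergodic A : measurable A -> odo @^-1` A = A -> P A = 0%E \/ P A = 1%E.
Proof.
move=> mA iA.
have p0 : 0 <= fine (P A) by exact: fine_ge0.
pose m1 : {measure set digits -> \bar R} := mrestr P mA.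
pose m2 : {measure set digits -> \bar R} := mscale (NngNum p0) P.
have e : m1 A = m2 A.
  have pf : P A \is a fin_num by exact: fin_num_measure.
  apply: (@cyl_measure_unique R 0) => //.
  - by rewrite /m1 /m2 /= /mrestr /mscale /= setTI unif_setT mule1 fineK.
  - by rewrite /m1 /= /mrestr setTI -ge0_fin_numE.
  - by move=> r c _; rewrite /m1 /m2 /= /mrestr /mscale /= invariant_cyl // unif_cyl.
move: e; rewrite /m1 /m2 /= /mrestr /mscale /= setIid.
have : P A \is a fin_num by exact: fin_num_measure.
case: (P A) => [r| |] //= _; rewrite -EFinM => -[] e.
have : r * (r - 1) == 0 by apply/eqP; rewrite mulrBr mulr1 -e subrr.
by rewrite mulf_eq0 subr_eq0 => /orP[/eqP ->|/eqP ->]; [left|right].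
Qed.

End odometer_ergodic.

(** * The skew product as an automorphism *)

Section skew_product.
Variable R : realType.
Local Notation P := (@unif R).

Definition mu2 : set (digits * digits) -> \bar R := (P \x P)%E.

HB.instance Definition _ := Measure.on mu2.

Lemma mu2_setT : mu2 setT = 1%E.
Proof. by rewrite -setXTT /mu2 /= product_measure1E //= unif_setT mule1. Qed.

HB.instance Definition _ := Measure_isProbability.Build _ _ R mu2 mu2_setT.

(** The fibre measure, identified in [cond_prob_fib] with the conditional probability given the
    base. *)
Definition fib (A : set (digits * digits)) (y : digits) : R := fine (P (xsection A y)).

Lemma fibE A y : measurable A -> (fib A y)%:E = P (xsection A y).
Proof. by move=> mA; rewrite fineK // fin_num_measure //; exact: measurable_xsection. Qed.

Lemma measurable_fib A : measurable A -> measurable_fun setT (fib A).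
Proof.
move=> mA; apply: measurableT_comp => //.
exact: (measurable_fun_xsection P mA).
Qed.

Lemma fib_ge0 A y : 0 <= fib A y.
Proof. exact: fine_ge0. Qed.

Lemma fib_le1 A y : measurable A -> fib A y <= 1.
Proof.
move=> mA; rewrite -lee_fin fibE //; apply: probability_le1.
exact: measurable_xsection.
Qed.

Lemma measurable_lead j : measurable [set y | lead y = j].
Proof.
(* The second piece accounts for the default value 0 at the all-2 sequence. *)
have -> : [set y | lead y = j] =
    [set y | full j y /\ y j != 2] `|` [set y | eventually2 0 y /\ j = 0%N].
  apply/seteqP; split=> [y /= <-|y /= [[fj yj]|[h ->]]].
  - have [[i yi]|n] := pselect (exists i, y i != 2).
      by left; have [_] := leadP yi.
    right; split.
      by move=> i _; apply/eqP/negPn/negP => yi; apply: n; exists i.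
    by rewrite /lead; case: pselect.
  - exact: lead_eq.
  - rewrite /lead; case: pselect => // e; exfalso.
    by case: e => i /negP; apply; apply/eqP; exact: h.
apply: measurableU.
  apply: (@measurable_level j.+1) => x x' xx' [fx xj]; split.
    by rewrite -(@full_agree j x x') //; exact: agree_leq xx'.
  by rewrite -xx'.
have [->|j0] := eqVneq j 0%N.
  rewrite (_ : [set _ | _] = eventually2 0); first exact: measurable_eventually2.
  by apply/seteqP; split=> y /=; [case|].
rewrite (_ : [set _ | _] = set0) // -subset0 => y [_ e].
by rewrite e in j0.
Qed.

(** [k] takes countably many values, and where it is constant the map is a product map. *)
Lemma measurable_skew f k V : measurable_fun setT f ->
  (forall j, measurable [set y | k y = j]) ->
  (forall j, measurable_fun setT (V j)) ->
  measurable_fun setT (skew f k V).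
Proof.
move=> mf mk mV _ A mA; rewrite setTI.
have -> : skew f k V @^-1` A = \bigcup_j ((fst @^-1` [set y | k y = j]) `&`
    (fun yx : digits * digits => (f yx.1, V j yx.2)) @^-1` A).
  apply/seteqP; split=> [yx h|yx [j _ [/= <- //]]].
  by exists (k yx.1).
apply: bigcupT_measurable => j; apply: measurableI.
  by rewrite -[X in measurable X]setTI; exact: measurable_fst.
rewrite -[X in measurable X]setTI.
have m : measurable_fun setT (fun yx : digits * digits => (f yx.1, V j yx.2)).
  apply: measurable_fun_pair.
    exact: (measurableT_comp mf measurable_fst).
  exact: (measurableT_comp (mV j) measurable_snd).
exact: m.
Qed.

Lemma measurable_tower : measurable_fun setT tower.
Proof.
apply: measurable_skew; first exact: measurable_odo.
  move=> [|j]; first by rewrite (_ : [set _ | _] = set0) // -subset0 => y.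
  rewrite (_ : [set _ | _] = [set y | lead y = j]); first exact: measurable_lead.
  by apply/seteqP; split=> y /=; [case|move=> ->].
by move=> j; have [/measurable_short] := rigid_spins j.
Qed.

Lemma measurable_tower_inv : measurable_fun setT tower_inv.
Proof.
apply: measurable_skew; first exact: measurable_odo_inv.
  move=> [|j]; first by rewrite (_ : [set _ | _] = set0) // -subset0 => y.
  rewrite (_ : [set _ | _] = odo_inv @^-1` [set y | lead y = j]).
    rewrite -[X in measurable X]setTI; apply: measurable_odo_inv => //.
    exact: measurable_lead.
  by apply/seteqP; split=> y /=; [case|move=> ->].
by move=> j; apply: measurable_short; exact: short_spins_inv.
Qed.

Lemma measurable_iter_tower n A : measurable A -> measurable (iter n tower @^-1` A).
Proof.
move=> mA; elim: n => [//|n IH].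
have -> : iter n.+1 tower @^-1` A = tower @^-1` (iter n tower @^-1` A).
  by apply/funext => y; rewrite /= -iterSr.
by rewrite -[X in measurable X]setTI; exact: measurable_tower.
Qed.

(** Over [y] the tower acts on the fibre by [spins], which is rigid and so preserves [P]. *)
Lemma fib_tower A y : measurable A -> fib (tower @^-1` A) y = fib A (odo y).
Proof.
move=> mA; rewrite /fib; congr fine.
rewrite -[RHS](unif_rigid R (rigid_spins (lead y).+1)); last exact: measurable_xsection.
by congr (P _); apply/seteqP; split=> x; rewrite /xsection /= !inE.
Qed.

Lemma fib_iter_tower n A y : measurable A ->
  fib (iter n tower @^-1` A) y = fib A (iter n odo y).
Proof.
move=> mA; elim: n y => [//|n IH] y.
have -> : iter n.+1 tower @^-1` A = tower @^-1` (iter n tower @^-1` A).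
  by apply/funext => z; rewrite /= -iterSr.
rewrite fib_tower; last exact: measurable_iter_tower.
by rewrite IH iterSr.
Qed.

Lemma mu2E A : measurable A -> mu2 A = (\int[P]_y (fib A y)%:E)%E.
Proof. by move=> mA; apply: eq_integral => y _; rewrite fibE. Qed.

Lemma integral_odo (f : digits -> \bar R) : measurable_fun setT f ->
  (forall y, 0 <= f y)%E -> (\int[P]_y f (odo y) = \int[P]_y f y)%E.
Proof.
move=> mf f0.
have := @ge0_integral_pushforward _ _ _ _ R odo measurable_odo P setT f measurableT.
rewrite preimage_setT => <- //.
apply: eq_measure_integral => [|mo A mA _]; first exact: measurable_odo.
exact: (unif_odo R mA).
Qed.

Lemma mu2_tower A : measurable A -> mu2 (tower @^-1` A) = mu2 A.
Proof.
move=> mA; rewrite !mu2E //; last exact: (measurable_iter_tower 1).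
under eq_integral do rewrite fib_tower //.
apply: (@integral_odo (fun y => (fib A y)%:E)).
  by apply/measurable_EFinP; exact: measurable_fib.
by move=> y; rewrite lee_fin fib_ge0.
Qed.

Lemma tower_automorphism : automorphism (mu2 : probability _ R) tower.
Proof.
split; [exact: measurable_tower|exact: mu2_tower|].
exists tower_inv; split; first exact: measurable_tower_inv.
  by apply: aeW => x; exact: towerK.
by apply: aeW => x; exact: tower_invK.
Qed.

End skew_product.

(** * Approximation by finitely determined sets *)

Lemma cvg0_lt (R : realType) (I : Type) (F : set_system I) (f : I -> \bar R)
    (e : R) : 0 < e -> f i @[i --> F] --> 0%E -> \forall i \near F, (f i < e%:E)%E.
Proof.
move=> e0 h; apply: (h [set x | (x < e%:E)%E]).
by apply: open_nbhs_nbhs; split; [exact: open_ereal_lt_ereal|rewrite /= lte_fin].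
Qed.

Lemma le_cvg0 (R : realType) (I : Type) (F : set_system I) {FF : Filter F}
    (f : I -> \bar R) : (forall i, 0 <= f i)%E ->
  (forall e : R, 0 < e -> \forall i \near F, (f i <= e%:E)%E) ->
  f i @[i --> F] --> 0%E.
Proof.
move=> f0 h; apply/fine_cvgP; split.
  apply: filterS (h 1 ltr01) => i fi.
  by rewrite ge0_fin_numE // (le_lt_trans fi) ?ltry.
apply/cvgr0Pnorm_le => e e0; apply: filterS (h e e0) => i fi /=.
rewrite ger0_norm ?fine_ge0 // -lee_fin fineK //.
by rewrite ge0_fin_numE // (le_lt_trans fi) ?ltry.
Qed.

Lemma measurable_gt_set (R : realType) d (T : measurableType d) (f : T -> R) c :
  measurable_fun setT f -> measurable [set x | c < f x].
Proof.
move=> mf; rewrite (_ : [set _ | _] = f @^-1` `]c, +oo[).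
  by rewrite -[X in measurable X]setTI; apply: mf => //; exact: measurable_itv.
by apply/seteqP; split=> y /=; rewrite in_itv /= andbT.
Qed.

Definition lev (q : nat) (A : set (digits * digits)) : Prop :=
  forall yx yx', agree q yx.1 yx'.1 -> agree q yx.2 yx'.2 -> A yx -> A yx'.

Lemma lev_leq q r A : (q <= r)%N -> lev q A -> lev r A.
Proof. by move=> qr lA a b h1 h2; apply: lA; exact: agree_leq qr _. Qed.

Lemma level_xsection q A y : lev q A -> level q (xsection A y).
Proof.
by move=> lA x x' h; rewrite /xsection /= !inE; exact: lA.
Qed.

Lemma measurable_lev q A : lev q A -> measurable A.
Proof.
move=> lA.
(* Extension by zeros picks one base point in the cylinder of the word [c]; the section of [A] is
   the same over the whole cylinder. *)
pose ext (c : {ffun 'I_q -> 'Z_3}) : digits := fun i => oapp c 0 (insub i).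
have -> : A = \bigcup_(c : {ffun 'I_q -> 'Z_3})
    ([set y : digits | forall i : 'I_q, y i = c i] `*` xsection A (ext c)).
  have e (c : {ffun 'I_q -> 'Z_3}) (y : digits) : (forall i : 'I_q, y i = c i) ->
      agree q y (ext c).
    by move=> h i iq; rewrite /ext insubT /= -h.
  apply/seteqP; split=> [[y x] Ayx|[y x] [c _ [/= yc]]].
    exists [ffun i : 'I_q => y i] => //; split=> /= [i|]; first by rewrite ffunE.
    rewrite /xsection /= inE; apply: lA Ayx => //=; apply: e => i.
    by rewrite ffunE.
  rewrite /xsection /= inE; apply: lA => //=; apply: agree_sym; exact: e.
apply: countable_bigcupT_measurable => // c; apply: measurableX.
  apply: (@measurable_level q) => x x' xx' h i.
  by rewrite -xx' // h.
by apply: measurable_level; exact: level_xsection lA.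
Qed.

Definition symdiff (T : Type) (A B : set T) : set T := (A `\` B) `|` (B `\` A).

Lemma symdiffC (T : Type) (A B : set T) : symdiff A B = symdiff B A.
Proof. exact: setUC. Qed.

Lemma measurable_symdiff d (T : measurableType d) (A B : set T) :
  measurable A -> measurable B -> measurable (symdiff A B).
Proof. by move=> mA mB; apply: measurableU; exact: measurableD. Qed.

Lemma symdiff_trans (T : Type) (A B C : set T) :
  symdiff A C `<=` symdiff A B `|` symdiff B C.
Proof.
by move=> x; rewrite /symdiff /=; have [Bx|Bx] := pselect (B x); tauto.
Qed.

Lemma symdiffU (T : Type) (A B A' B' : set T) :
  symdiff (A `|` B) (A' `|` B') `<=` symdiff A A' `|` symdiff B B'.
Proof.
move=> x; rewrite /symdiff /=.
by have [Bx|Bx] := pselect (B x); have [Ax|Ax] := pselect (A x); tauto.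
Qed.

Lemma symdiffNN (T : Type) (A A' : set T) : symdiff (~` A) (~` A') = symdiff A A'.
Proof.
apply/seteqP; split=> x; rewrite /symdiff /=;
  by have [Bx|Bx] := pselect (A' x); have [Ax|Ax] := pselect (A x); tauto.
Qed.

Section approximation.
Variable R : realType.
Local Notation P := (@unif R).
Local Notation mu := (@mu2 R).

Definition approx (A : set (digits * digits)) : Prop :=
  measurable A /\ forall e : R, 0 < e ->
    exists q A', lev q A' /\ (mu (symdiff A A') <= e%:E)%E.

Lemma mu_symdiff_trans A B C : measurable A -> measurable B -> measurable C ->
  (mu (symdiff A C) <= mu (symdiff A B) + mu (symdiff B C))%E.
Proof.
move=> mA mB mC; have h := measurable_symdiff.
apply: le_trans (measureU2 _ _ _); try exact: measurable_symdiff.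
by apply: le_measure; rewrite ?inE;
  [exact: h|apply: measurableU; exact: h|exact: symdiff_trans].
Qed.

Lemma approx_limit A : measurable A ->
  (forall e : R, 0 < e -> exists B, approx B /\ (mu (symdiff A B) <= e%:E)%E) ->
  approx A.
Proof.
move=> mA h; split => // e e0; have e20 : 0 < e / 2 by rewrite divr_gt0.
have [B [[mB aB] AB]] := h _ e20; have [q [A' [lA' BA']]] := aB _ e20.
exists q, A'; split => //.
apply: le_trans (mu_symdiff_trans mA mB (measurable_lev lA')) _.
by rewrite [e]splitr EFinD leeD.
Qed.

Lemma approx_setC A : approx A -> approx (~` A).
Proof.
move=> [mA aA]; split=> [|e /aA [q [A' [lA' AA']]]]; first exact: measurableC.
exists q, (~` A'); rewrite symdiffNN; split => // a b h1 h2 na Ab; apply: na.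
by apply: lA' Ab; exact: agree_sym.
Qed.

Lemma approx_setU A B : approx A -> approx B -> approx (A `|` B).
Proof.
move=> [mA aA] [mB aB]; split=> [|e e0]; first exact: measurableU.
have e20 : 0 < e / 2 by rewrite divr_gt0.
have [q [A' [lA' AA']]] := aA _ e20; have [r [B' [lB' BB']]] := aB _ e20.
exists (maxn q r), (A' `|` B'); split.
  move=> a b h1 h2 [Aa|Ba]; [left|right].
    by apply: (lev_leq (leq_maxl q r) lA') Aa.
  by apply: (lev_leq (leq_maxr q r) lB') Ba.
have mA' := measurable_lev lA'; have mB' := measurable_lev lB'.
have h := measurable_symdiff.
apply: (@le_trans _ _ (mu (symdiff A A') + mu (symdiff B B'))%E); last first.
  by rewrite [e]splitr EFinD leeD.
apply: le_trans (measureU2 _ _ _); try exact: measurable_symdiff.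
apply: le_measure; rewrite ?inE; last exact: symdiffU.
  by apply: h; exact: measurableU.
by apply: measurableU; exact: h.
Qed.

Lemma approx_lev q A : lev q A -> approx A.
Proof.
move=> lA; split; first exact: measurable_lev lA.
move=> e e0; exists q, A; split => //.
by rewrite /symdiff setDv setU0 measure0 lee_fin ltW.
Qed.

Lemma approx_set0 : approx set0.
Proof. by apply: (@approx_lev 0). Qed.

(** Finite unions are approximable, and what they miss decreases to the empty set, so its measure
    tends to 0. *)
Lemma approx_bigcup (F : (set (digits * digits))^nat) :
  (forall i, approx (F i)) -> approx (\bigcup_i F i).
Proof.
move=> aF; have mF i : measurable (F i) by case: (aF i).
have mU : measurable (\bigcup_i F i) by exact: bigcupT_measurable.
pose U n := \big[setU/set0]_(i < n) F i.
have aU n : approx (U n).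
  rewrite /U; elim: n => [|n IH]; first by rewrite big_ord0; exact: approx_set0.
  by rewrite big_ord_recr; exact: approx_setU.
have UF n : U n `<=` \bigcup_i F i.
  by rewrite /U -bigcup_mkord => x [i _ Fx]; exists i.
apply: approx_limit => // e e0.
pose G n := (\bigcup_i F i) `\` U n.
have mG n : measurable (G n) by apply: measurableD => //; case: (aU n).
have G0 : \bigcap_n G n = set0.
  rewrite -subset0 => x Gx; have [[i _ Fx] _] := Gx 0%N Logic.I.
  have [_] := Gx i.+1 Logic.I; apply.
  by rewrite /U big_ord_recr /=; right.
have cG : mu (G n) @[n --> \oo] --> 0%E.
  rewrite -(measure0 mu) -G0; apply: nonincreasing_cvg_mu => //.
  - by rewrite -ge0_fin_numE //; exact: fin_num_measure.
  - by rewrite G0; exact: measurable0.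
  - move=> m n mn; apply/subsetPset; apply: setDS.
    by rewrite /U -!bigcup_mkord => x [i im Fx]; exists i => //; exact: leq_trans mn.
have [n _ /(_ n (leqnn n)) hn] := cvg0_lt e0 cG.
exists (U n); split => //.
rewrite (_ : symdiff _ _ = G n) ?ltW //.
by rewrite /symdiff (_ : U n `\` _ = set0) ?setU0 // setD_eq0; exact: UF.
Qed.

Lemma approx_preimage (f : digits * digits -> digits) :
  (forall q A, level q A -> lev q (f @^-1` A)) ->
  forall A, measurable A -> approx (f @^-1` A).
Proof.
move=> hf A mA; pose K := [set A | approx (f @^-1` A)].
apply: (@smallest_sub _ (sigma_algebra setT) cylinders K _ _ A mA).
  split; first by rewrite /K /= preimage_set0; exact: approx_set0.
    by move=> B aB; rewrite /K /= setTD preimage_setC; exact: approx_setC.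
  by move=> F aF; rewrite /K /= preimage_bigcup; exact: approx_bigcup.
move=> _ [q [c ->]]; apply: approx_lev; apply: hf; exact: level_cyl.
Qed.

(** The approximable sets form a sigma-algebra containing the preimages of measurable sets under
    both projections, which generate the product. *)
Lemma approx_measurable A : measurable A -> approx A.
Proof.
move=> mA.
apply: (@smallest_sub _ (sigma_algebra setT) _ approx _ _ A mA).
  split; [exact: approx_set0| |exact: approx_bigcup].
  by move=> B aB; rewrite setTD; exact: approx_setC.
move=> _ [[B mB <-]|[B mB <-]]; rewrite setTI; apply: approx_preimage => //.
  by move=> q C lC a b h1 h2; apply: lC.
by move=> q C lC a b h1 h2; apply: lC.
Qed.

(** * Mixing along the fibres *)

(** Markov's inequality: a set of small measure has small fibres over most base points. *)
Lemma fib_markov D (c : R) : measurable D -> 0 < c ->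
  (c%:E * P [set y | (c < fib R D y)%R] <= mu D)%E.
Proof.
move=> mD c0; have mfD := @measurable_fib R _ mD.
have mS : measurable [set y | c < fib R D y].
  exact: measurable_gt_set.
set S := [set y | _] in mS *.
have mE : measurable_fun setT (fun y => (fib R D y)%:E) by exact/measurable_EFinP.
rewrite mu2E // -integral_cst //.
have h1 : (\int[P]_(y in S) (cst c%:E) y <= \int[P]_(y in S) (fib R D y)%:E)%E.
  apply: ge0_le_integral => //.
  - by move=> y _; rewrite lee_fin ltW.
  - exact: measurable_funTS.
  - by move=> y Sy; rewrite lee_fin ltW.
apply: (le_trans h1); apply: ge0_subset_integral => //.
by move=> y _; rewrite lee_fin fib_ge0.
Qed.

Lemma fib_setI_sub (A B A' B' : set (digits * digits)) y :
  measurable A -> measurable B -> measurable A' -> measurable B' ->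
  fib R (A `&` B) y <= fib R (A' `&` B') y + fib R (symdiff A A') y + fib R (symdiff B B') y.
Proof.
move=> mA mB mA' mB'; have h := measurable_symdiff.
rewrite -lee_fin !EFinD !fibE; try exact: h; try exact: measurableI.
have mx (C : set (digits * digits)) : measurable C -> measurable (xsection C y).
  exact: measurable_xsection.
apply: (@le_trans _ _ (P (xsection (A' `&` B') y
  `|` xsection (symdiff A A') y `|` xsection (symdiff B B') y))).
  apply: le_measure; rewrite ?inE.
  - by apply: mx; exact: measurableI.
  - by apply: measurableU; [apply: measurableU|]; apply: mx; [exact: measurableI|exact: h|exact: h].
  - move=> x; rewrite /xsection /symdiff /= !inE /=.
    by have [Bx|Bx] := pselect (B' (y, x)); have [Ax|Ax] := pselect (A' (y, x)); tauto.
apply: le_trans (measureU2 _ _ _) _.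
- by apply: measurableU; apply: mx; [exact: measurableI|exact: h].
- by apply: mx; exact: h.
apply: leeD => //; apply: measureU2; apply: mx; [exact: measurableI|exact: h].
Qed.

Lemma fib_sub (A A' : set (digits * digits)) y : measurable A -> measurable A' ->
  fib R A y <= fib R A' y + fib R (symdiff A A') y.
Proof.
move=> mA mA'; have := fib_setI_sub y mA measurableT mA' measurableT.
rewrite !setIT => /le_trans; apply.
rewrite (_ : symdiff setT setT = set0); last by rewrite /symdiff setDv setU0.
by rewrite /fib xsection0 measure0 addr0.
Qed.

(** Independence is exact here: off the exceptional set some number [p] of digits absorbs the [n]
    additions, and in the coordinate z of x = [mix p y] z the two events are those of [unif_mix]. *)
Lemma fib_mixing_lev q n A B y : lev q A -> lev q B -> (3 ^ q <= n)%N ->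
  ~ eventually2 n y ->
  fib R (A `&` iter n tower @^-1` B) y = fib R A y * fib R (iter n tower @^-1` B) y.
Proof.
move=> lA lB qn ny.
have mA := measurable_lev lA; have mB := measurable_lev lB.
have [i ni yi] : exists2 i, (n <= i)%N & y i != 2.
  apply: contrapT => h; apply: ny => i ni; apply/eqP/negPn/negP => yi.
  by apply: h; exists i.
have := exists_value ni yi; move: i.+1 => p v.
rewrite fib_iter_tower // /fib -fineM; last 2 first.
- by apply: fin_num_measure; exact: measurable_xsection.
- by apply: fin_num_measure; exact: measurable_xsection.
congr fine.
rewrite -(unif_rigid R (rigid_mix p y)); last first.
  apply: measurable_xsection; apply: measurableI => //.
  exact: measurable_iter_tower.
have := @unif_mix R q n p y (iter n odo y) _ _ qn (value_iter_odo_small v)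
  (level_xsection (y := y) lA) (level_xsection (y := iter n odo y) lB).
move=> <-; congr (P _).
by apply/seteqP; split=> z; rewrite /xsection /= !inE /= iter_tower.
Qed.

Definition fib_cov (A B : set (digits * digits)) n y : R :=
  fib R (A `&` iter n tower @^-1` B) y - fib R A y * fib R (iter n tower @^-1` B) y.

Lemma measurable_fib_cov A B n : measurable A -> measurable B ->
  measurable_fun setT (fib_cov A B n).
Proof.
move=> mA mB; have mTB := measurable_iter_tower n mB.
apply: measurable_funB; first by apply: measurable_fib; exact: measurableI.
by apply: measurable_funM; exact: measurable_fib.
Qed.

(** The covariance of [A'] and [B'] vanishes by [fib_mixing_lev]. Passing to [A] and [B] changes the
    joint term and the product by at most the sum of the two fibre errors each, hence the factors
    2. *)
Lemma fib_cov_le q n A B A' B' y : measurable A -> measurable B ->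
  lev q A' -> lev q B' -> (3 ^ q <= n)%N -> ~ eventually2 n y ->
  `|fib_cov A B n y| <= 2 * fib R (symdiff A A') y
     + 2 * fib R (iter n tower @^-1` symdiff B B') y.
Proof.
move=> mA mB lA lB qn ny; rewrite /fib_cov.
have e := fib_mixing_lev lA lB qn ny.
have mA' := measurable_lev lA; have mB' := measurable_lev lB.
have mTB := measurable_iter_tower n mB; have mTB' := measurable_iter_tower n mB'.
have := fib_setI_sub y mA mTB mA' mTB'; have := fib_setI_sub y mA' mTB' mA mTB.
have := fib_sub y mA mA'; have := fib_sub y mA' mA.
have := fib_sub y mTB mTB'; have := fib_sub y mTB' mTB.
rewrite (symdiffC A' A) (symdiffC (_ @^-1` B')) e.
rewrite (_ : symdiff (iter n tower @^-1` B) _ = iter n tower @^-1` symdiff B B') //.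
have := fib_le1 R y mA; have := fib_ge0 R A y.
have := fib_le1 R y mA'; have := fib_ge0 R A' y.
have := fib_le1 R y mTB; have := fib_ge0 R (iter n tower @^-1` B) y.
have := fib_le1 R y mTB'; have := fib_ge0 R (iter n tower @^-1` B') y.
have := fib_ge0 R (symdiff A A') y.
have := fib_ge0 R (iter n tower @^-1` symdiff B B') y.
move: (fib _ _ _) (fib _ _ _) => d2 d1.
move: (fib _ _ _) (fib _ _ _) (fib _ _ _) (fib _ _ _) (fib _ _ _) => *.
by rewrite ler_norml; apply/andP; split; nra.
Qed.

End approximation.

(** * Ergodicity and conditional probabilities *)

Section relative.
Variable R : realType.
Local Notation P := (@unif R).
Local Notation mu := (@mu2 R).
Local Notation mup := (@mu2 R : probability (digits * digits)%type R).

Lemma mu2_fst B : measurable B -> mu (fst @^-1` B) = P B.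
Proof.
move=> mB; rewrite (_ : fst @^-1` B = B `*` setT).
  by rewrite /mu2 /= product_measure1E //= unif_setT mule1.
by apply/seteqP; split=> [[y x]|[y x] []].
Qed.

Lemma mu2_iter_tower n A : measurable A -> mu (iter n tower @^-1` A) = mu A.
Proof.
move=> mA; elim: n => [//|n IH].
have -> : iter n.+1 tower @^-1` A = tower @^-1` (iter n tower @^-1` A).
  by apply/funext => z; rewrite /= -iterSr.
by rewrite mu2_tower //; exact: measurable_iter_tower.
Qed.

Lemma measurable_normr_gt d (T : measurableType d) (f : T -> R) e :
  measurable_fun setT f -> measurable [set x | e < `|f x|].
Proof.
by move=> mf; apply: measurable_gt_set; exact: measurableT_comp.
Qed.

Lemma fib_mixing A B (e del : R) : measurable A -> measurable B ->
  0 < e -> 0 < del -> exists N, forall n, (N <= n)%N ->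
  (P [set y | (e < `|fib_cov R A B n y|)%R] <= del%:E)%E.
Proof.
move=> mA mB e0 d0.
have e40 : 0 < e / 4 by rewrite divr_gt0.
(* Markov's inequality at height e / 4 costs del / 2 for each of the two approximations, and the
   bound of [fib_cov_le] then adds up to e. *)
pose eta := e / 4 * (del / 2).
have eta0 : 0 < eta by rewrite mulr_gt0 // divr_gt0.
have [_ /(_ _ eta0)[q [A' [lA' hA]]]] := approx_measurable R mA.
have [_ /(_ _ eta0)[r [B' [lB' hB]]]] := approx_measurable R mB.
have {}lA' := lev_leq (leq_maxl q r) lA'; have {}lB' := lev_leq (leq_maxr q r) lB'.
have mA' := measurable_lev lA'; have mB' := measurable_lev lB'.
have msA := measurable_symdiff mA mA'; have msB := measurable_symdiff mB mB'.
exists (3 ^ maxn q r)%N => n qn.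
have mTs := measurable_iter_tower n msB.
have bound D : measurable D -> (mu D <= eta%:E)%E ->
    (P [set y | (e / 4 < fib R D y)%R] <= (del / 2)%:E)%E.
  move=> mD hD; have := le_trans (fib_markov mD e40) hD.
  by rewrite /eta (EFinM (e / 4)) lee_pmul2l // ?lte_fin // fin_numE.
have m1 := measurable_gt_set (e / 4) (@measurable_fib R _ msA).
have m2 := measurable_gt_set (e / 4) (@measurable_fib R _ mTs).
have m0 := measurable_eventually2 n.
apply: (@le_trans _ _ (P (eventually2 n `|` ([set y | (e / 4 < fib R (symdiff A A') y)%R]
   `|` [set y | (e / 4 < fib R (iter n tower @^-1` symdiff B B') y)%R])))).
  apply: le_measure; rewrite ?inE.
  - by apply: measurable_normr_gt; exact: measurable_fib_cov.
  - by apply: measurableU => //; exact: measurableU.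
  - move=> y /= h; have [ny|ny] := pselect (eventually2 n y); first by left.
    right; have := fib_cov_le R mA mB lA' lB' qn ny => hy.
    have [l1|l1] := ltP (e / 4) (fib R (symdiff A A') y); first by left.
    by right; lra.
apply: le_trans (measureU2 _ _ _) _ => //; first exact: measurableU.
rewrite /= unif_eventually2 add0e; apply: le_trans (measureU2 _ _ _) _ => //.
rewrite [del]splitr EFinD leeD //; apply: bound => //.
by rewrite mu2_iter_tower.
Qed.

(** Relative mixing of an invariant [A] with itself makes [fib A] equal to its square almost
    everywhere. So [mu A] is the measure of the base set where [fib A] is 1, which is invariant
    under [odo]. *)
Lemma tower_ergodic : ergodic mup tower.
Proof.
move=> A mA iA.
have iAn n : iter n tower @^-1` A = A.
  by elim: n => // n IH; rewrite -{2}IH -{2}iA.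
have fib01 : \forall y \ae P, fib R A y = 0 \/ fib R A y = 1.
  (* Each of these countably many bounds holds almost surely: by invariance the covariance is the
     same at all times, while its tail probability becomes arbitrarily small. *)
  have h : \forall y \ae P, forall k : nat,
      `|fib R A y - fib R A y * fib R A y| <= k.+1%:R^-1.
    apply: ae_foralln => k; exists [set y | k.+1%:R^-1 < `|fib R A y - fib R A y * fib R A y|].
    split; last by move=> y /= /negP; rewrite -ltNge.
      apply: measurable_normr_gt; apply: measurable_funB; last apply: measurable_funM;
        exact: measurable_fib.
    apply/eqP; rewrite eq_le measure_ge0 andbT; apply/lee_addgt0Pr => d d0.
    have [|N hN] := @fib_mixing A A k.+1%:R^-1 d mA mA _ d0; first by rewrite invr_gt0.
    by have := hN N (leqnn N); rewrite add0e /fib_cov iAn setIid.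
  apply: filterS h => y hy.
  have : fib R A y * (1 - fib R A y) = 0.
    apply/eqP; rewrite mulrBr mulr1 -normr_eq0 eq_le normr_ge0 andbT.
    apply/ler_addgt0Pr => d d0; rewrite add0r.
    apply: le_trans (hy (Num.truncn d^-1)) _.
    by rewrite invf_ple ?posrE // ltW // truncnS_gt.
  by move=> /eqP; rewrite mulf_eq0 subr_eq0 => /orP[/eqP ->|/eqP <-]; [left|right].
pose B := [set y | fib R A y = 1].
have mB : measurable B.
  rewrite (_ : B = fib R A @^-1` [set 1]) //.
  by rewrite -[X in measurable X]setTI; exact: measurable_fib.
have iB : odo @^-1` B = B.
  by apply/seteqP; split=> y; rewrite /B /= -fib_tower // iA.
have -> : mup A = P B.
  have -> : P B = (\int[P]_y (\1_B y)%:E)%E by rewrite integral_indic // setIT.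
  rewrite /= mu2E //.
  apply: ae_eq_integral => //.
  - by apply/measurable_EFinP; exact: measurable_fib.
  - by apply/measurable_EFinP; exact: measurable_indic.
  - apply: filterS fib01 => y h _; rewrite indicE; congr (_%:E).
    have [yB|yB] := boolP (y \in B); first by move/set_mem : yB.
    by case: h => // h; move/negP: yB; case; rewrite inE.
exact: odo_ergodic.
Qed.

Definition fst_sets : set (set (digits * digits)) :=
  preimage_set_system setT fst (@measurable _ digits).

Lemma sigma_algebra_fst_sets : sigma_algebra setT fst_sets.
Proof.
apply: sigma_algebra_preimage; split => //.
- by move=> A mA; rewrite setTD; exact: measurableC.
- by move=> F mF; exact: bigcupT_measurable.
Qed.

Lemma fst_sets_measurable : fst_sets `<=` measurable.
Proof. by move=> _ [B mB <-]; exact: measurable_fst. Qed.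

Lemma tower_factor : is_factor tower fst_sets.
Proof.
split; [exact: sigma_algebra_fst_sets|exact: fst_sets_measurable|].
apply/seteqP; split.
  move=> _ [_ [B mB <-] <-]; exists (odo @^-1` B).
    by rewrite -[X in measurable X]setTI; exact: measurable_odo.
  by rewrite !setTI.
move=> _ [B mB <-]; exists (fst @^-1` (odo_inv @^-1` B)).
  exists (odo_inv @^-1` B); last by rewrite setTI.
  by rewrite -[X in measurable X]setTI; exact: measurable_odo_inv.
by rewrite setTI; apply/seteqP; split=> -[y x] /=; rewrite odoK.
Qed.

(** By Fubini, the defining property of a conditional probability given the base. *)
Lemma integral_fib A B : measurable A -> measurable B ->
  (\int[mu]_(x in fst @^-1` B) (fib R A x.1)%:E = mu (A `&` fst @^-1` B))%E.
Proof.
move=> mA mB.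
have mfB : measurable (fst @^-1` B : set (digits * digits)).
  by rewrite -[X in measurable X]setTI; exact: measurable_fst.
have mE : measurable_fun setT (fun y => (fib R A y)%:E).
  by apply/measurable_EFinP; exact: measurable_fib.
rewrite mu2E; last exact: measurableI.
transitivity (\int[P]_(y in B) (fib R A y)%:E)%E.
  have := @ge0_integral_pushforward _ _ _ _ R fst measurable_fst mu B
    (fun y => (fib R A y)%:E) mB (measurable_funTS mE).
  move=> <-; last by move=> y _; rewrite lee_fin fib_ge0.
  apply: eq_measure_integral => C mC _.
  exact: mu2_fst.
rewrite integral_mkcond; apply: eq_integral => y _; rewrite patchE.
case: ifPn => yB; rewrite /fib.
  congr (fine (P _))%:E; apply/seteqP; split=> x; rewrite /xsection /= !inE /=.
    by move=> ?; split => //; exact: set_mem.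
  by case.
rewrite (_ : xsection _ y = set0) ?measure0 // -subset0 => x.
by rewrite /xsection /= inE /= => -[_ By]; move/negP: yB; apply; rewrite inE.
Qed.

(** Both sides are measurable for the factor and have equal integrals over its sets. *)
Lemma cond_prob_fib A : measurable A ->
  \forall x \ae mu, cond_prob mup fst_sets A x = fib R A x.1.
Proof.
move=> mA.
have [mf intf fE] := cond_probP mup sigma_algebra_fst_sets fst_sets_measurable mA.
set f := cond_prob _ _ _ in mf intf fE *.
(* Integrals are compared only over sets of the factor, so uniqueness is applied on the space with
   this smaller sigma-algebra, to the image of [mu] under the identity; null sets there are null for
   [mu]. *)
pose Z := g_sigma_algebraType fst_sets.
have mid : measurable_fun setT (id : digits * digits -> Z).
  move=> _ B mB; rewrite setTI; apply: fst_sets_measurable.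
  have : <<s fst_sets >> `<=` fst_sets by rewrite (sigma_algebra_id sigma_algebra_fst_sets).
  exact.
pose m : {measure set Z -> \bar R} :=
  measure_function_pushforward__canonical__measure_function_Measure mu mid.
have HZ (B : set Z) : measurable B -> fst_sets B.
  have : <<s fst_sets >> `<=` fst_sets by rewrite (sigma_algebra_id sigma_algebra_fst_sets).
  exact.
have mEf : measurable_fun setT (EFin \o (f : Z -> R)) by exact/measurable_EFinP.
have mEg : measurable_fun setT (fun x : Z => (fib R A x.1)%:E).
  apply/measurable_EFinP => _ C mC; rewrite setTI; apply: sub_sigma_algebra.
  exists (fib R A @^-1` C); last by rewrite setTI.
  by rewrite -[X in measurable X]setTI; exact: measurable_fib.
have h : ae_eq m setT (EFin \o (f : Z -> R)) (fun x : Z => (fib R A x.1)%:E).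
  apply: integral_ae_eq => //.
  - apply/integrableP; split => //.
    rewrite (ge0_integral_pushforward mid) //; last exact: measurableT_comp.
    by case/integrableP: intf.
  - move=> E _ mE; have [B mB BE] := HZ E mE.
    have iE : (\int[mu]_(x in E) (f x)%:E = mu (A `&` E))%E by apply: fE; exact: HZ.
    transitivity (\int[mu]_(x in E) (f x)%:E)%E.
      apply: (integral_pushforward mid mEf) => //.
      apply: integrableS intf => //; exact: fst_sets_measurable (HZ _ mE).
    transitivity (\int[mu]_(x in E) (fib R A x.1)%:E)%E.
      by rewrite iE -BE setTI integral_fib.
    apply/esym; apply: (ge0_integral_pushforward mid) => //.
      exact: measurable_funTS.
    by move=> x _; rewrite lee_fin fib_ge0.
case: h => N [mN N0 hN]; exists N; split => //.
  by apply: fst_sets_measurable; exact: HZ.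
by move=> x hx; apply: hN => /= e; apply: hx; have := e Logic.I => -[].
Qed.

End relative.

(** * Relative mixing *)

Section relative_mixing.
Variable R : realType.
Local Notation P := (@unif R).
Local Notation mu := (@mu2 R).
Local Notation mup := (@mu2 R : probability (digits * digits)%type R).

Lemma mu2_ae_le (A B : set (digits * digits)) : measurable A -> measurable B ->
  (\forall x \ae mu, A x -> B x) -> (mu A <= mu B)%E.
Proof.
move=> mA mB [N [mN N0 hN]].
rewrite -[leRHS]adde0 -N0; apply: le_trans (measureU2 _ _ _) => //.
apply: le_measure; rewrite ?inE //; first exact: measurableU.
move=> x Ax; have [Bx|Bx] := pselect (B x); [by left|right].
by apply: hN => /= h; apply: Bx; exact: h.
Qed.

Lemma measurable_cond_prob A : measurable A ->
  measurable_fun setT (cond_prob mup fst_sets A).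
Proof.
move=> mA; have [mf _ _] := cond_probP mup sigma_algebra_fst_sets fst_sets_measurable mA.
move=> _ B mB; rewrite setTI; apply: fst_sets_measurable.
have : <<s fst_sets >> `<=` fst_sets by rewrite (sigma_algebra_id sigma_algebra_fst_sets).
by apply; rewrite -[X in _ X]setTI; exact: mf.
Qed.

Lemma tower_relatively_mixing : relatively_mixing mup fst_sets tower.
Proof.
move=> A B mA mB e e0.
have mTB n := measurable_iter_tower n mB.
apply: le_cvg0 => [n|d d0]; first exact: measure_ge0.
have [N hN] := fib_mixing mA mB e0 d0.
exists N => // n Nn; apply: le_trans (hN n Nn).
rewrite -mu2_fst; last by apply: measurable_normr_gt; exact: measurable_fib_cov.
apply: mu2_ae_le.
- apply: measurable_normr_gt; apply: measurable_funB.
    by apply: measurable_cond_prob; exact: measurableI.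
  by apply: measurable_funM; exact: measurable_cond_prob.
- rewrite -[X in measurable X]setTI; apply: measurable_fst => //.
  by apply: measurable_normr_gt; exact: measurable_fib_cov.
- apply: filterS3 (cond_prob_fib R (measurableI _ _ mA (mTB n))) (cond_prob_fib R mA)
    (cond_prob_fib R (mTB n)) => x h1 h2 h3 /=.
  by rewrite h1 h2 h3.
Qed.

Lemma fib_digit0 (a : 'Z_3) n y :
  fib R (iter n tower @^-1` [set yx | yx.2 0%N = a]) y = 3^-1.
Proof.
have m0 : measurable ([set yx : digits * digits | yx.2 0%N = a]).
  apply: (@measurable_lev 1) => yx yx' _ h /= <-.
  by rewrite h.
rewrite fib_iter_tower // /fib -[RHS](_ : fine (3^-1)%:E = _) //; congr fine.
rewrite -[3^-1](expr1 _) exprVn -(unif_cyl R 1 (fun=> a)); congr (P _).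
apply/seteqP; split=> x; rewrite /xsection /= inE /=; first by move=> h [].
by apply.
Qed.

Lemma cube_third_gt : 28^-1 < `|0 - 3^-1 * 3^-1 * 3^-1| :> R.
Proof. by rewrite sub0r normrN ger0_norm; lra. Qed.

(** When digit [N] of the base point is 0, an event of measure 1/3, the first fibre digits at times
    0, 3^N and 2 * 3^N sum to 0. They cannot be 0, 0, 1, so the joint conditional probability is 0,
    against a product of 1/27. *)
Lemma tower_not_threefold : ~ relatively_threefold_mixing mup fst_sets tower.
Proof.
pose A (a : 'Z_3) := [set yx : digits * digits | yx.2 0%N = a].
have mA a : measurable (A a).
  by apply: (@measurable_lev 1) => yx yx' _ h /= <-; rewrite h.
(* The threshold 1/28 lies just below the discrepancy 1/27. *)
move=> /(_ (A 0) (A 0) (A 1) (mA _) (mA _) (mA _) (28^-1)).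
have e0 : (0 : R) < 28^-1 by rewrite invr_gt0.
have e1 : (0 : R) < 3^-1 by rewrite invr_gt0.
move=> /(_ e0)/(cvg0_lt e1)[N /(_ (3 ^ N) (2 * 3 ^ N))%N].
have h1 : (N <= 3 ^ N)%N by apply/ltnW/ltn_expl.
have h2 : (3 ^ N + N <= 2 * 3 ^ N)%N by lia.
move=> /(_ h1 h2) /=; apply/negP; rewrite -leNgt -(unif_digit0 R N).
have mT n a := measurable_iter_tower n (mA a).
rewrite -mu2_fst; last exact: measurable_digit.
have m3 := measurableI _ _ (measurableI _ _ (mA 0) (mT (3 ^ N)%N 0)) (mT (2 * 3 ^ N)%N 1).
apply: mu2_ae_le.
- by rewrite -[X in measurable X]setTI; apply: measurable_fst => //; exact: measurable_digit.
- apply: measurable_normr_gt; apply: measurable_funB; first exact: measurable_cond_prob.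
  by do 2 ?apply: measurable_funM; exact: measurable_cond_prob.
- have c1 := cond_prob_fib R (mA 0); have c2 := cond_prob_fib R (mT (3 ^ N)%N 0).
  have c3 := cond_prob_fib R (mT (2 * 3 ^ N)%N 1); have c4 := cond_prob_fib R m3.
  apply: filterS3 (filterI c1 c2) c3 c4 => x [k1 k2] k3 k4 /= yN.
  rewrite k1 k2 k3 k4.
  have := fib_digit0 0 0 x.1; rewrite /= -/(A 0) => ->.
  rewrite !fib_digit0.
  rewrite (_ : fib _ _ _ = 0).
    exact: cube_third_gt.
  rewrite /fib (_ : xsection _ _ = set0) ?measure0 // -subset0 => z.
  rewrite /xsection /= inE => -[[]]; rewrite /A /= => z0 zj zk.
  have := tower_zero_sum z yN; rewrite z0 zj zk => /eqP.
  by [].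
Qed.

End relative_mixing.

(** * The space is standard Borel *)

Definition pagree (q : nat) (a b : digits * digits) : Prop :=
  agree q a.1 b.1 /\ agree q a.2 b.2.

Lemma pagree_sym q a b : pagree q a b -> pagree q b a.
Proof. by move=> [h1 h2]; split; exact: agree_sym. Qed.

Lemma pagree_trans q b a c : pagree q a b -> pagree q b c -> pagree q a c.
Proof. by move=> [h1 h2] [h3 h4]; split; [exact: agree_trans h3|exact: agree_trans h4]. Qed.

Lemma pagree_leq q r a b : (q <= r)%N -> pagree r a b -> pagree q a b.
Proof. by move=> qr [h1 h2]; split; exact: agree_leq qr _. Qed.

Lemma pagree_eq a b : (forall q, pagree q a b) -> a = b.
Proof.
case: a b => [a1 a2] [b1 b2] h; congr pair; apply/funext => i;
  by have [h1 h2] := h i.+1; (apply: h1 || apply: h2).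
Qed.

(** A copy of the product, indexed by the field of distances, that carries the common-prefix
    metric. *)
Definition digit_pairs (R : realType) : Type := (digits * digits)%type.

Section digit_pairs_metric.
Variable R : realType.
Local Notation Y := (digit_pairs R).

HB.instance Definition _ := Pointed.copy Y (digits * digits)%type.

(** Radius 1/(q+1) means agreement on [q] digits in both coordinates. Requiring [0 < e] makes the
    triangle inequality hold for all real radii. *)
Let pball (a : Y) (e : R) : set Y :=
  [set b | 0 < e /\ forall q, e <= q.+1%:R^-1 -> pagree q a b].

Let ent : set_system (Y * Y) := entourage_ pball.

Let pnbhs (a : Y) : set_system Y := nbhs_ ent a.

Let pnbhsE : pnbhs = nbhs_ ent. Proof. by []. Qed.

HB.instance Definition _ := hasNbhs.Build Y pnbhs.

Let pball_center a (e : R) : 0 < e -> pball a e a.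
Proof. by []. Qed.

Let pball_sym a b (e : R) : pball a e b -> pball b e a.
Proof. by move=> [e0 h]; split=> // q /h; exact: pagree_sym. Qed.

Let pball_triangle a b c (e1 e2 : R) :
  pball a e1 b -> pball b e2 c -> pball a (e1 + e2) c.
Proof.
move=> [e10 h1] [e20 h2]; split=> [|q qe]; first exact: addr_gt0.
by apply: (@pagree_trans _ b); [apply: h1|apply: h2]; apply: le_trans qe;
  rewrite ?lerDl ?lerDr ltW.
Qed.

Let entE : ent = entourage_ pball. Proof. by []. Qed.

HB.instance Definition _ := @Nbhs_isPseudoMetric.Build R Y
  ent pnbhsE pball pball_center pball_sym pball_triangle entE.

Lemma ball_pagree q (a b : Y) : ball a (q.+1%:R^-1 : R) b <-> pagree q a b.
Proof.
split=> [[_]|h]; first exact.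
split=> [|r]; first by rewrite invr_gt0.
rewrite lef_pV2 ?posrE // ler_nat ltnS => rq.
exact: pagree_leq h.
Qed.

Lemma exists_radius (e : R) : 0 < e -> exists q, q.+1%:R^-1 <= e.
Proof.
move=> e0; exists (Num.truncn e^-1).
by rewrite invf_ple ?posrE // ltW // truncnS_gt.
Qed.

Lemma digit_pairs_complete (F : set_system Y) :
  ProperFilter F -> cauchy F -> cvg F.
Proof.
move=> PF /cauchyP Fc.
have /choice[c hc] q : exists c : Y, F (ball c (q.+1%:R^-1 : R)).
  by apply: Fc; rewrite invr_gt0.
have cc q r : (q <= r)%N -> pagree q (c q) (c r).
  move=> qr; have [z [/ball_pagree h1 /ball_pagree h2]] := filter_ex (filterI (hc q) (hc r)).
  by apply: pagree_trans h1 _; apply: pagree_leq qr _; exact: pagree_sym.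
(* A diagonal limit: from [c i.+1] on, digit [i] of the centres no longer changes. *)
pose l : Y := (fun i => (c i.+1).1 i, fun i => (c i.+1).2 i).
have lc q : pagree q l (c q).
  by split=> i iq; have [h1 h2] := cc _ _ iq; [exact: h1|exact: h2].
apply/cvg_ex; exists l; apply/fcvg_ballP => e e0.
have [q qe] := exists_radius e0.
apply: filterS (hc q) => z /ball_pagree h; apply: (le_ball qe).
by apply/ball_pagree; exact: pagree_trans h.
Qed.

HB.instance Definition _ := Uniform_isComplete.Build Y digit_pairs_complete.

(** Indexing by finite words, a countable type, yields a countable base of the topology. *)
Definition prefix_set (s : seq ('Z_3 * 'Z_3)) : set (digits * digits) :=
  [set a | forall i, (i < size s)%N -> (a.1 i, a.2 i) = nth (0, 0) s i].

Definition prefix_of (q : nat) (a : digits * digits) : seq ('Z_3 * 'Z_3) :=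
  [seq (a.1 i, a.2 i) | i <- iota 0 q].

Lemma prefix_setP q a b : prefix_set (prefix_of q a) b <-> pagree q a b.
Proof.
have e i : (i < q)%N -> nth (0, 0) (prefix_of q a) i = (a.1 i, a.2 i).
  by move=> iq; rewrite (nth_map 0%N) ?size_iota // nth_iota.
rewrite /prefix_set /= size_map size_iota; split=> [h|[h1 h2] i iq].
  by split=> i iq; have := h i iq; rewrite e // => -[].
by rewrite e // h1 // h2.
Qed.

Lemma lev_prefix s : lev (size s) (prefix_set s).
Proof. by move=> a b h1 h2 h i iq; rewrite -h1 // -h2 // h. Qed.

Lemma open_lev q (A : set Y) : lev q A -> open A.
Proof.
move=> lA; rewrite openE => a Aa; apply/nbhs_ballP; exists q.+1%:R^-1.
  by rewrite /= invr_gt0.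
by move=> b /ball_pagree[h1 h2]; exact: lA Aa.
Qed.

Lemma open_prefix (U : set Y) a : open U -> U a ->
  exists2 s, prefix_set s a & prefix_set s `<=` U.
Proof.
move=> oU Ua; have /nbhs_ballP[e e0 eU] := open_nbhs_nbhs (conj oU Ua).
have [q qe] := exists_radius e0.
exists (prefix_of q a); first by apply/prefix_setP.
by move=> b /prefix_setP h; apply: eU; apply: (le_ball qe); exact/ball_pagree.
Qed.

Lemma digit_pairs_hausdorff : hausdorff_space Y.
Proof.
move=> a b ab; apply: pagree_eq => q.
have nb (c : Y) : nbhs c (ball c (q.+1%:R^-1 : R)).
  by apply: nbhsx_ballx; rewrite invr_gt0.
have [z [/ball_pagree h1 /ball_pagree h2]] := ab _ _ (nb a) (nb b).
by apply: pagree_trans h1 _; exact: pagree_sym.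
Qed.

Lemma digit_pairs_second_countable : @second_countable Y.
Proof.
exists (range (prefix_set : _ -> set Y)).
  by apply: card_le_trans (card_image_le _ _) _; exact: countableP.
split=> [_ [s _ <-]|a A /=]; first exact: open_lev (@lev_prefix s).
rewrite nbhsE => -[U [oU Ua] UA].
have [s sa sU] := open_prefix oU Ua.
exists (prefix_set s); first by split => //; exists s.
exact: subset_trans UA.
Qed.

(** The two sigma-algebras coincide: preimages of cylinders under the projections are open, and an
    open set is the countable union of the prefix sets it contains. *)
Lemma digit_pairs_standard_borel : standard_borel R (digits * digits)%type.
Proof.
exists Y, id; split.
- exact: digit_pairs_hausdorff.
- exact: digit_pairs_second_countable.
- by exists id.
have sig : sigma_algebra setT <<s @open Y >> by exact: smallest_sigma_algebra.
move=> A; rewrite image_id; split=> hA.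
  have gen (f : Y -> digits) : (forall q B, level q B -> lev q (f @^-1` B)) ->
      forall B, measurable B -> <<s @open Y >> (f @^-1` B).
    move=> hf B mB.
    apply: (@smallest_sub _ (sigma_algebra setT) cylinders
      [set B | <<s @open Y >> (f @^-1` B)] _ _ B mB).
      have [s0 sC sU] := sig; split=> [|C hC|F hF] /=.
      + by rewrite preimage_set0.
      + by rewrite setTD preimage_setC -setTD; exact: sC.
      + by rewrite preimage_bigcup; exact: sU.
    move=> _ [q [c ->]]; apply: sub_sigma_algebra; apply: (@open_lev q).
    by apply: hf; exact: level_cyl.
  apply: (@smallest_sub _ (sigma_algebra setT) _ _ sig _ A hA).
  move=> _ [[B mB <-]|[B mB <-]]; rewrite setTI; apply: gen => //.
    by move=> q C lC a b h1 h2; apply: lC.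
  by move=> q C lC a b h1 h2; apply: lC.
apply: (@smallest_sub _ (sigma_algebra setT) (@open Y) measurable _ _ A hA).
  split; first exact: measurable0.
    by move=> B mB; rewrite setTD; exact: measurableC.
  by move=> F mF; exact: bigcupT_measurable.
move=> U oU; have -> : U = \bigcup_s (if pselect (prefix_set s `<=` U)
    then prefix_set s else set0).
  apply/seteqP; split=> [a Ua|a [s _]].
    by have [s sa sU] := open_prefix oU Ua; exists s => //; case: pselect.
  by case: pselect => // sU; exact: sU.
apply: countable_bigcupT_measurable => // s; case: pselect => h /=.
  exact: measurable_lev (@lev_prefix s).
exact: measurable0.
Qed.

End digit_pairs_metric.

Theorem theorem1p1 (R : realType) :
  exists (d : measure_display) (X : measurableType d) (mu : probability X R)
         (T : X -> X) (H : set (set X)),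
    lebesgue_space mu /\ automorphism mu T /\ ergodic mu T /\ is_factor T H /\
    relatively_mixing mu H T /\ ~ relatively_threefold_mixing mu H T.
Proof.
exists _, (digits * digits)%type, (@mu2 R), tower, fst_sets; split.
  exact: digit_pairs_standard_borel.
split; first exact: tower_automorphism.
split; first exact: tower_ergodic.
split; first exact: tower_factor.
split; first exact: tower_relatively_mixing.
exact: tower_not_threefold.
Qed.
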